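(* Let $p$ be a prime and let $\beta\in\mathbb{Q}_p$ with $|\beta|_p>1$. Then $$\mathrm{Fin}(\beta)=\mathbb{A}_p[\beta^{-1}]\cap\mathbb{Z}_p$$ if and only if $\beta$ is a Pisot-Chabauty number and its minimal polynomial $$x^n-a_1x^{n-1}-\cdots-a_n,\qquad a_i\in\mathbb{A}_p,$$ fulfills both $$\max_{2\le i\le n}|a_i|_p<|a_1|_p$$ (a condition that is vacuous if $n=1$) and $$-\mathbf{a}\in\mathcal{D}_n^0,\quad\text{where }\mathbf{a}:=(a_n,\dots,a_1).$$
   Context: Let $p$ be a prime, $\mathbb{Z}_p\subset\mathbb{Q}_p$ the $p$-adic integers and $p$-adic numbers, $|\cdot|_p$ the $p$-adic absolute value with $|p|_p=p^{-1}$, extended uniquely to algebraic extensions of $\mathbb{Q}_p$, and $|\cdot|_\infty$ the usual absolute value on $\mathbb{C}$. Put $\mathbb{A}_p:=\mathbb{Z}[\tfrac1p]=\{mp^n:m,n\in\mathbb{Z}\}\subset\mathbb{Q}\subset\mathbb{Q}_p$; $\mathbb{A}_p[\beta^{-1}]$ is the subring of $\mathbb{Q}_p$ generated by $\mathbb{A}_p$ and $\beta^{-1}$. Algebraic integers over $\mathbb{A}_p$: an element $\alpha$ is an algebraic integer over $\mathbb{A}_p$ if it is a root of a monic polynomial irreducible over $\mathbb{A}_p$ with coefficients in $\mathbb{A}_p$, called its minimal polynomial. If $n$ is its degree, the non-archimedean conjugates $\alpha_1=\alpha,\alpha_2,\dots,\alpha_n$ of $\alpha$ are the roots of the minimal polynomial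 in an algebraic closure of $\mathbb{Q}_p$, and the archimedean conjugates $\alpha_{n+1},\dots,\alpha_{2n}$ are its roots in $\mathbb{C}$. Pisot-Chabauty (PC) number: a number $\alpha\in\mathbb{Q}_p$ such that (i) $\alpha_1:=\alpha$ is an algebraic integer over $\mathbb{A}_p$; (ii) $|\alpha_1|_p>1$; (iii) $|\alpha_i|_p\le 1$ for all other non-archimedean conjugates, $i=2,\dots,n$; (iv) $|\alpha_i|_\infty<1$ for all archimedean conjugates, $i=n+1,\dots,2n$. Integer and fractional part: each $x\in\mathbb{Q}_p$ is uniquely $x=\sum_{i\ge n_0}x_ip^i$ with $x_i\in\{0,\dots,p-1\}$; put $\lfloor x\rfloor_p:=\sum_{i\ge0}x_ip^i\in\mathbb{Z}_p$ and $\{x\}_p:=\sum_{i<0}x_ip^i\in\mathbb{A}_p\cap[0,1)$. Beta-expansion: for $\beta\in\mathbb{Q}_p$ with $|\beta|_p>1$ let $T:\mathbb{Z}_p\to\mathbb{Z}_p$, $T(x)=\lfloor\beta x\rfloor_p$. For $\alpha\in\mathbb{Z}_p$ the beta-expansion $d_\beta(\alpha)$ is the sequence $(d_k)_{k\ge1}$ with $d_k=\{\beta T^{k-1}(\alpha)\}_p$. It is called finite if $d_k=0$ for all sufficiently large $k$. $\mathrm{Fin}(\beta)$ is the set of $\alpha\in\mathbb{Z}_p$ for which $d_\beta(\alpha)$ is finite. Shift radix systems: for $\mathbf{r}=(r_1,\dots,r_n)\in\mathbb{R}^n$ define $\tilde\tau_{\mathbf{r}}:\mathbb{Z}^n\to\mathbb{Z}^n$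 by $$\tilde\tau_{\mathbf{r}}(z_1,\dots,z_n)=(z_2,\dots,z_n,-\lfloor r_1z_1+\cdots+r_nz_n\rfloor),$$ with $\lfloor\cdot\rfloor$ the real floor function, and $$\mathcal{D}_n^0:=\{\mathbf{r}\in\mathbb{R}^n:\ \forall\,\mathbf{z}\in\mathbb{Z}^n\ \exists\,k>0:\ \tilde\tau_{\mathbf{r}}^k(\mathbf{z})=\mathbf{0}\}.$$ The coefficients $a_i\in\mathbb{A}_p\subset\mathbb{Q}$ are regarded as real numbers when forming $-\mathbf{a}$. *)

(* Defs.v *)
From HB Require Import structures.
From mathcomp Require Import all_boot all_order all_algebra.
From mathcomp Require Import fraction complex.
From mathcomp Require Import all_classical reals.

Set Implicit Arguments.
Unset Strict Implicit.
Unset Printing Implicit Defensive.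

Import Order.TTheory GRing.Theory Num.Theory.

Local Open Scope ring_scope.
Local Open Scope classical_set_scope.

(* Z_p is the inverse limit of the rings Z/p^n; the class mod p^n is           *)
(* represented by its residue in {0, ..., p^n - 1}.                            *)
Record padic_int (p : nat) (p_pr : prime p) := PadicInt {
  padic_res : nat -> nat;
  padic_resP : forall n, (padic_res n.+1 %% p ^ n)%N = padic_res n }.

Section PadicInt.
Context (p : nat) (p_pr : prime p).
Local Notation Zp := (padic_int p_pr).
Implicit Types x y z : Zp.

HB.instance Definition _ := gen_eqMixin Zp.
HB.instance Definition _ := gen_choiceMixin Zp.

Lemma padic_intP x y : padic_res x =1 padic_res y -> x = y.
Proof.
case: x y => [f fP] [g gP] /= /funext fg; move: fP gP; rewrite fg => fP gP.
by congr PadicInt; exact: Prop_irrelevance.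
Qed.

Lemma padic_res_mod x n : (padic_res x n %% p ^ n)%N = padic_res x n.
Proof. by rewrite -{1}padic_resP modn_mod padic_resP. Qed.

Lemma padic_resD x n m : (padic_res x (n + m) %% p ^ n)%N = padic_res x n.
Proof.
elim: m => [|m IH]; first by rewrite addn0 padic_res_mod.
by rewrite -IH addnS -[in RHS]padic_resP modn_dvdm // dvdn_exp2l // leq_addr.
Qed.

Lemma padic_lim_subproof (f : nat -> nat) :
  (forall n, f n.+1 = f n %[mod p ^ n]) ->
  forall n, (f n.+1 %% p ^ n.+1 %% p ^ n)%N = (f n %% p ^ n)%N.
Proof. by move=> fP n; rewrite modn_dvdm ?dvdn_exp2l. Qed.

(* The p-adic limit of a sequence of naturals with f (n + 1) = f n mod p^n. *)
Definition padic_lim f (fP : forall n, f n.+1 = f n %[mod p ^ n]) : Zp :=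
  PadicInt p_pr (padic_lim_subproof fP).

Lemma padic_nat_subproof (k n : nat) : k = k %[mod p ^ n].
Proof. by []. Qed.
Definition padic_nat k : Zp := padic_lim (padic_nat_subproof k).

Lemma padic_add_subproof x y n :
  (padic_res x n.+1 + padic_res y n.+1 = padic_res x n + padic_res y n %[mod p ^ n])%N.
Proof. by rewrite -modnDm !padic_resP. Qed.
Definition padic_add x y : Zp := padic_lim (padic_add_subproof x y).

Lemma padic_opp_subproof x n :
  (p ^ n.+1 - padic_res x n.+1 = p ^ n - padic_res x n %[mod p ^ n])%N.
Proof.
have lt k : (padic_res x k <= p ^ k)%N.
  by rewrite -padic_res_mod ltnW // ltn_mod expn_gt0 prime_gt0.
apply/eqP; rewrite -(eqn_modDr (padic_res x n.+1)) subnK ?lt //.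
rewrite -modnDmr padic_resP subnK ?lt //.
by rewrite modnn -/(_ %| _)%N dvdn_exp2l.
Qed.
Definition padic_opp x : Zp := padic_lim (padic_opp_subproof x).

Lemma padic_mul_subproof x y n :
  (padic_res x n.+1 * padic_res y n.+1 = padic_res x n * padic_res y n %[mod p ^ n])%N.
Proof. by rewrite -modnMm !padic_resP. Qed.
Definition padic_mul x y : Zp := padic_lim (padic_mul_subproof x y).

Lemma padic_addA : associative padic_add.
Proof. by move=> x y z; apply: padic_intP => n /=; rewrite modnDml modnDmr addnA. Qed.

Lemma padic_addC : commutative padic_add.
Proof. by move=> x y; apply: padic_intP => n /=; rewrite addnC. Qed.

Lemma padic_add0 : left_id (padic_nat 0) padic_add.
Proof. by move=> x; apply: padic_intP => n /=; rewrite mod0n add0n padic_res_mod. Qed.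

Lemma padic_addN : left_inverse (padic_nat 0) padic_opp padic_add.
Proof.
move=> x; apply: padic_intP => n /=; rewrite modnDml subnK ?modnn ?mod0n //.
by rewrite -padic_res_mod ltnW // ltn_mod expn_gt0 prime_gt0.
Qed.

HB.instance Definition _ :=
  GRing.isZmodule.Build Zp padic_addA padic_addC padic_add0 padic_addN.

Lemma padic_mulA : associative padic_mul.
Proof. by move=> x y z; apply: padic_intP => n /=; rewrite modnMml modnMmr mulnA. Qed.

Lemma padic_mulC : commutative padic_mul.
Proof. by move=> x y; apply: padic_intP => n /=; rewrite mulnC. Qed.

Lemma padic_mul1 : left_id (padic_nat 1) padic_mul.
Proof. by move=> x; apply: padic_intP => n /=; rewrite modnMml mul1n padic_res_mod. Qed.

Lemma padic_mulD : left_distributive padic_mul +%R.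
Proof.
by move=> x y z; apply: padic_intP => n /=; rewrite modnMml modnDm mulnDl.
Qed.

Lemma padic_1neq0 : padic_nat 1 != 0.
Proof.
apply/eqP => /(congr1 (fun x => padic_res x 1)) /=.
by rewrite mod0n expn1 modn_small ?prime_gt1.
Qed.

HB.instance Definition _ := GRing.Zmodule_isComNzRing.Build Zp
  padic_mulA padic_mulC padic_mul1 padic_mulD padic_1neq0.

Lemma padic_res_natr k n : padic_res (k%:R : Zp) n = (k %% p ^ n)%N.
Proof.
elim: k n => [|k IH] n; first by rewrite mulr0n /= mod0n.
by rewrite mulrS /= IH modnDm add1n.
Qed.

Lemma padic_res0 n : padic_res (0 : Zp) n = 0%N.
Proof. by rewrite /= mod0n. Qed.

Lemma padic_res_mul x y n :
  padic_res (x * y) n = (padic_res x n * padic_res y n %% p ^ n)%N.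
Proof. by []. Qed.

Lemma padic_res_add x y n :
  padic_res (x + y) n = ((padic_res x n + padic_res y n) %% p ^ n)%N.
Proof. by []. Qed.

Definition padic_unit : {pred Zp} := fun x => `[< exists y, y * x = 1 >].

Definition padic_inv x : Zp :=
  if pselect (exists y, y * x = 1) is left e then projT1 (cid e) else x.

Lemma padic_mulV : {in padic_unit, left_inverse 1 padic_inv *%R}.
Proof.
move=> x /asboolP ux; rewrite /padic_inv; case: pselect => // e.
exact: (projT2 (cid e)).
Qed.

Lemma padic_unitPl x y : y * x = 1 -> padic_unit x.
Proof. by move=> yx; apply/asboolP; exists y. Qed.

Lemma padic_inv_out : {in [predC padic_unit], padic_inv =1 id}.
Proof.
move=> x /negP nux; rewrite /padic_inv; case: pselect => // e.
by case: nux; apply/asboolP.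
Qed.

HB.instance Definition _ := GRing.ComNzRing_hasMulInverse.Build Zp
  padic_mulV padic_unitPl padic_inv_out.

Lemma padic_neq0P x : x != 0 -> exists n, padic_res x n.+1 != 0%N.
Proof.
move=> x0; apply: contrapT => /forallNP h; case/eqP: x0; apply: padic_intP => n.
rewrite padic_res0 -padic_resP; have /negP := h n.
by rewrite negbK => /eqP ->; rewrite mod0n.
Qed.

Lemma padic_dvd_res x m n : (m <= n)%N -> (p ^ m %| padic_res x n)%N = (padic_res x m == 0%N).
Proof. by move=> mn; rewrite /dvdn -{1}(subnKC mn) padic_resD. Qed.

Lemma padic_integral x y : x * y = 0 -> (x == 0) || (y == 0).
Proof.
move=> xy0; apply/negPn; rewrite negb_or; apply/negP => /andP[].
move=> /padic_neq0P[m xm] /padic_neq0P[n yn].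
have /(congr1 (fun z => padic_res z (m.+1 + n.+1))) := xy0.
rewrite padic_res0 padic_res_mul => /eqP; rewrite -/(dvdn _ _).
move: xm yn; rewrite -(padic_dvd_res x (leq_addr n.+1 m.+1)).
rewrite -(padic_dvd_res y (leq_addl m.+1 n.+1)).
set a := padic_res x _; set b := padic_res y _ => xm yn.
have a0 : (0 < a)%N by case: a xm => //; rewrite dvdn0.
have b0 : (0 < b)%N by case: b yn => //; rewrite dvdn0.
rewrite !pfactor_dvdn ?muln_gt0 ?a0 // lognM //.
move: xm yn; rewrite !pfactor_dvdn // -!ltnNge !ltnS => xm yn.
by apply/negP; rewrite -ltnNge addSn ltnS addnS leqW // leq_add.
Qed.

HB.instance Definition _ := GRing.ComUnitRing_isIntegral.Build Zp padic_integral.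

Lemma padic_modSn a b n : a = b %[mod p ^ n.+1] -> a = b %[mod p ^ n].
Proof.
by move=> e; rewrite -(modn_dvdm a (dvdn_exp2l p (leqnSn n))) e modn_dvdm ?dvdn_exp2l.
Qed.

Lemma padic_egcdn x n : padic_res x 1 != 0%N ->
  (padic_res x n * (egcdn (padic_res x n) (p ^ n)).1 = 1 %[mod p ^ n])%N.
Proof.
case: n => [|n] x1; first by rewrite expn0 !modn1.
have pNx : ~~ (p %| padic_res x n.+1)%N.
  by have := padic_dvd_res x (isT : (1 <= n.+1)%N); rewrite expn1 => ->.
have x_gt0 : (0 < padic_res x n.+1)%N.
  by case: (padic_res x n.+1) pNx => //; rewrite dvdn0.
have cop : coprime (padic_res x n.+1) (p ^ n.+1).
  by rewrite coprime_sym coprimeXl // prime_coprime.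
case: egcdnP => //= a b e _.
by rewrite mulnC e (eqP cop) modnMDl.
Qed.

Lemma padic_inv_subproof x :
  padic_res x 1 != 0%N -> forall n,
  ((egcdn (padic_res x n.+1) (p ^ n.+1)).1 =
   (egcdn (padic_res x n) (p ^ n)).1 %[mod p ^ n])%N.
Proof.
move=> x1 n; have := padic_egcdn n x1; have /padic_modSn := padic_egcdn n.+1 x1.
set a := (egcdn _ _).1; set b := (egcdn _ _).1.
rewrite -modnMml padic_resP => ea eb.
transitivity ((a * (padic_res x n * b)) %% p ^ n)%N.
  by rewrite -modnMmr eb modnMmr muln1.
by rewrite mulnA [(a * _)%N]mulnC -modnMml ea modnMml mul1n.
Qed.

Lemma padic_unitP x : reflect (padic_res x 1 != 0%N) (x \is a GRing.unit).
Proof.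
apply: (iffP idP) => [/mulVr|x1].
  move=> /(congr1 (fun z => padic_res z 1)) /=; rewrite expn1 => h.
  apply/eqP => x0; move: h; rewrite x0 muln0 mod0n modn_small ?prime_gt1 //.
apply/asboolP; exists (padic_lim (padic_inv_subproof x1)).
apply: padic_intP => n; rewrite padic_res_mul /= modnMml mulnC.
exact: padic_egcdn.
Qed.

Definition padic_digit x (i : nat) : nat := (padic_res x i.+1 %/ p ^ i)%N.

Lemma padic_digit_lt x i : (padic_digit x i < p)%N.
Proof.
rewrite /padic_digit ltn_divLR ?expn_gt0 ?prime_gt0 // -expnS.
by rewrite -padic_res_mod ltn_mod expn_gt0 prime_gt0.
Qed.

Lemma padic_res_digits x n :
  padic_res x n = (\sum_(i < n) padic_digit x i * p ^ i)%N.
Proof.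
elim: n => [|n IH]; first by rewrite big_ord0 -padic_res_mod modn1.
by rewrite big_ord_recr /= -IH -[padic_res x n]padic_resP addnC -divn_eq.
Qed.

Lemma padic_series_subproof (d : nat -> nat) n :
  (\sum_(i < n.+1) d i * p ^ i = \sum_(i < n) d i * p ^ i %[mod p ^ n])%N.
Proof. by rewrite big_ord_recr /= addnC modnMDl. Qed.

(* The sum of the convergent series d_0 + d_1 p + d_2 p^2 + ...               *)
Definition padic_series (d : nat -> nat) : Zp :=
  padic_lim (padic_series_subproof d).

Lemma padic_series_digit x m :
  x = (padic_res x m)%:R + p%:R ^+ m * padic_series (fun i => padic_digit x (m + i)).
Proof.
apply: padic_intP => n; rewrite padic_res_add padic_res_mul -natrX.
rewrite !padic_res_natr modnMml modnDm.
have -> : padic_res (padic_series (fun i => padic_digit x (m + i))) n =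
    ((\sum_(i < n) padic_digit x (m + i) * p ^ i) %% p ^ n)%N by [].
rewrite -modnDmr modnMmr modnDmr -(padic_resD x n m) [in LHS]padic_res_digits.
rewrite addnC big_split_ord /= -padic_res_digits big_distrr /=.
by congr ((_ + _) %% _)%N; apply: eq_bigr => i _; rewrite expnD mulnCA.
Qed.

Definition padic_val x : nat :=
  if pselect (exists n, padic_res x n.+1 != 0%N) is left e then ex_minn e else 0.

Lemma padic_valP x : x != 0 ->
  exists2 u, u \is a GRing.unit & x = p%:R ^+ padic_val x * u.
Proof.
move=> /padic_neq0P x0; rewrite /padic_val; case: pselect => // e.
case: ex_minnP => v xv vmin.
have xv0 : padic_res x v = 0%N.
  case: v {xv} vmin => [|v] vmin; first by rewrite -padic_res_mod modn1.
  by apply/eqP/negPn/negP => /vmin; rewrite ltnn.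
exists (padic_series (fun i => padic_digit x (v + i))); last first.
  by rewrite {1}(padic_series_digit x v) xv0 add0r.
apply/padic_unitP => /=; rewrite big_ord1 addn0 expn1 muln1.
rewrite modn_small ?padic_digit_lt //; apply: contraNneq xv => d0.
by rewrite padic_res_digits big_ord_recr /= -padic_res_digits xv0 d0.
Qed.

Lemma padic_res_natp1 : padic_res (p%:R : Zp) 1 = 0%N.
Proof. by rewrite padic_res_natr expn1 modnn. Qed.

Lemma padic_natp_neq0 : p%:R != 0 :> Zp.
Proof.
apply/eqP => /(congr1 (fun z => padic_res z 2)) /eqP.
rewrite padic_res_natr padic_res0 -/(dvdn _ _) => /(dvdn_leq (prime_gt0 p_pr)).
by rewrite leqNgt -mulnn ltn_Pmulr ?prime_gt1 ?prime_gt0.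
Qed.

Lemma padic_val_unit k (u : Zp) : u \is a GRing.unit -> padic_val (p%:R ^+ k * u) = k.
Proof.
move=> uu; have pk0 j : p%:R ^+ j != 0 :> Zp by rewrite expf_neq0 ?padic_natp_neq0.
have npu j (v w : Zp) : v \is a GRing.unit -> v = p%:R ^+ j.+1 * w -> False.
  move=> /padic_unitP /eqP vu vE; apply: vu.
  by rewrite vE exprS -mulrA padic_res_mul padic_res_natp1 mul0n mod0n.
have nz : p%:R ^+ k * u != 0 by rewrite mulf_neq0 //; apply: contraTneq uu => ->; rewrite unitr0.
have [w uw] := padic_valP nz; set j := padic_val _ => e.
case: (ltngtP j k) => // [jk|kj].
  move: e; rewrite -(subnKC jk) addSnnS exprD -mulrA => /(mulfI (pk0 _)) /esym.
  by move/(npu _ _ _ uw).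
move: e; rewrite -(subnKC kj) addSnnS exprD -mulrA => /(mulfI (pk0 _)).
by move/(npu _ _ _ uu).
Qed.

Lemma padic_valM x y : x != 0 -> y != 0 ->
  padic_val (x * y) = (padic_val x + padic_val y)%N.
Proof.
move=> /padic_valP[u uu ->] /padic_valP[w uw ->]; rewrite mulrACA -exprD.
by rewrite !padic_val_unit ?unitrM ?uu.
Qed.

Lemma padic_val_ge k x : p%:R ^+ k * x != 0 -> (k <= padic_val (p%:R ^+ k * x)%R)%N.
Proof.
move=> kx0; have x0 : x != 0 by apply: contraNneq kx0 => ->; rewrite mulr0.
by have [u uu ->] := padic_valP x0; rewrite mulrA -exprD padic_val_unit ?leq_addr.
Qed.

End PadicInt.

Notation padic p_pr := {fraction padic_int p_pr}.
Notation "x %:F" := (tofrac x).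

Section Padic.
Context (p : nat) (p_pr : prime p).
Local Notation Zp := (padic_int p_pr).
Local Notation Qp := (padic p_pr).

Lemma padic_numden (x : Qp) : x = (\n_(repr x))%:F / (\d_(repr x))%:F.
Proof.
have d0 : (\d_(repr x))%:F != 0 :> Qp by rewrite tofrac_eq0 denom_ratioP.
apply: (canRL (mulfK d0)); rewrite -[x in x * _]reprK; unlock tofrac.
rewrite -[LHS]FracField.pi_mul; apply/eqmodP => /=.
rewrite /FracField.mulf /equivf /= !numden_Ratio ?oner_neq0 ?mulr1 ?denom_ratioP //.
by rewrite mulrC.
Qed.

Definition padic_int_norm (z : Zp) : rat :=
  if z == 0 then 0 else p%:R ^- padic_val z.

Lemma padic_int_norm_eq0 z : (padic_int_norm z == 0) = (z == 0).
Proof.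
rewrite /padic_int_norm; case: (z == 0) => //.
by apply/negbTE; rewrite invr_eq0 expf_neq0 // pnatr_eq0 -lt0n prime_gt0.
Qed.

Lemma padic_int_normM : {morph padic_int_norm : x y / x * y}.
Proof.
move=> x y; rewrite /padic_int_norm mulf_eq0.
have [_|x0] := eqVneq x; first by rewrite mul0r.
have [_|y0] := eqVneq y; first by rewrite mulr0.
by rewrite /= padic_valM // exprD invfM.
Qed.

(* The absolute value on Q_p, computed on a representation of x as a quotient *)
(* of p-adic integers; it does not depend on the quotient (padic_norm_div).   *)
Definition padic_norm (x : Qp) : rat :=
  padic_int_norm \n_(repr x) / padic_int_norm \d_(repr x).

Lemma padic_norm_div (a b : Zp) : b != 0 ->
  padic_norm (a%:F / b%:F) = padic_int_norm a / padic_int_norm b.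
Proof.
move=> b0; rewrite /padic_norm; set x : Qp := _ / b%:F; have := padic_numden x.
set n := \n_(repr x); have d0 := denom_ratioP (repr x); set d := \d_(repr x) in d0 *.
move/eqP; rewrite eqr_div ?tofrac_eq0 // -!tofracM tofrac_eq => /eqP e.
by apply/eqP; rewrite eqr_div ?padic_int_norm_eq0 // -!padic_int_normM e.
Qed.

Lemma padic_norm_tofrac (z : Zp) : padic_norm z%:F = padic_int_norm z.
Proof.
have h : padic_int_norm 1 != 0 by rewrite padic_int_norm_eq0 oner_neq0.
have -> : z%:F = z%:F / 1%:F :> Qp by rewrite tofrac1 divr1.
rewrite padic_norm_div ?oner_neq0 //.
by apply: (canLR (mulfK h)); rewrite -padic_int_normM mulr1.
Qed.

Lemma padic_normM : {morph padic_norm : x y / x * y}.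
Proof.
move=> x y; rewrite {1}(padic_numden x) {1}(padic_numden y) mulrACA -invfM -!tofracM.
rewrite padic_norm_div ?mulf_neq0 ?denom_ratioP //.
by rewrite !padic_int_normM invfM mulrACA.
Qed.

Lemma padic_norm_eq0 x : (padic_norm x == 0) = (x == 0).
Proof.
rewrite [in RHS](padic_numden x) /padic_norm !mulf_eq0 !invr_eq0.
by rewrite !padic_int_norm_eq0 !tofrac_eq0.
Qed.

Lemma padic_norm_ge0 x : 0 <= padic_norm x.
Proof.
by rewrite divr_ge0 // /padic_int_norm; case: ifP; rewrite // invr_ge0 exprn_ge0.
Qed.

Lemma padic_norm_natp : padic_norm p%:R = p%:R^-1.
Proof.
have -> : p%:R = (p%:R : Zp)%:F :> Qp by rewrite rmorph_nat.
rewrite padic_norm_tofrac /padic_int_norm (negbTE (padic_natp_neq0 p_pr)).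
by have := padic_val_unit 1 (unitr1 Zp); rewrite expr1 mulr1 => ->; rewrite expr1.
Qed.

Lemma padic_norm_le1 x : (padic_norm x <= 1) <-> exists z : Zp, x = z%:F.
Proof.
have p1 : 1 < p%:R :> rat by rewrite ltr1n prime_gt1.
have p0 : 0 < p%:R :> rat by rewrite ltr0n prime_gt0.
split=> [|[z ->]]; last first.
  rewrite padic_norm_tofrac /padic_int_norm; case: eqP => // _.
  by rewrite invf_le1 ?exprn_gt0 // exprn_ege1 // ltW.
rewrite [X in exists z, X = _](padic_numden x) /padic_norm.
move: (\n_(repr x)) (\d_(repr x)) (denom_ratioP (repr x)) => n d d0.
have [->|n0] := eqVneq n 0; first by exists 0; rewrite !tofrac0 mul0r.
rewrite /padic_int_norm (negbTE n0) (negbTE d0) invrK.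
rewrite ler_pdivrMl ?exprn_gt0 // mulr1 ler_eXn2l //.
have [u uu nE] := padic_valP n0; have [w uw dE] := padic_valP d0 => le.
exists (p%:R ^+ (padic_val n - padic_val d) * u / w).
apply: (canLR (mulfK _)); rewrite ?tofrac_eq0 // -tofracM; congr (_%:F).
rewrite {2}dE [_ * w]mulrC mulrA mulrVK // mulrAC -exprD subnK //.
Qed.

Lemma padic_normD x y : padic_norm (x + y) <= Num.max (padic_norm x) (padic_norm y).
Proof.
wlog xy : x y / padic_norm x <= padic_norm y.
  move=> h; have /orP[/h//|/h] := le_total (padic_norm x) (padic_norm y).
  by rewrite addrC maxC.
rewrite (max_idPr xy); have [y0|y0] := eqVneq y 0.
  suff -> : x = 0 by rewrite add0r.
  apply/eqP; rewrite -padic_norm_eq0 eq_le padic_norm_ge0 andbT.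
  by apply: le_trans xy _; rewrite y0 le_eqVlt padic_norm_eq0 eqxx.
have y1 : 0 < padic_norm y by rewrite lt_def padic_norm_eq0 y0 padic_norm_ge0.
have /padic_norm_le1[z zE] : padic_norm (x / y) <= 1.
  by rewrite -(ler_pM2r y1) -padic_normM mulfVK // mul1r.
have -> : x + y = (z + 1)%:F * y by rewrite tofracD tofrac1 mulrDl -zE mulfVK // mul1r.
by rewrite padic_normM ler_piMl ?padic_norm_ge0 //; apply/padic_norm_le1; exists (z + 1).
Qed.

Lemma padic_natr_eq0 k : (k%:R == 0 :> Qp) = (k == 0%N).
Proof.
apply/eqP/eqP => [|->//]; rewrite -(rmorph_nat (@tofrac Zp)) => /eqP.
rewrite tofrac_eq0 => /eqP /(congr1 (fun z => padic_res z k)).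
by rewrite padic_res_natr padic_res0 modn_small // ltn_expl ?prime_gt1.
Qed.

Lemma padic_intr_eq0 k : (k%:~R == 0 :> Qp) = (k == 0).
Proof. by case: k => k; rewrite ?NegzE ?mulrNz ?oppr_eq0 padic_natr_eq0. Qed.

Lemma ratr_padic_quot a b : b != 0%N ->
  ratr (a%:R / b%:R) = a%:R / b%:R :> Qp.
Proof.
move=> b0; rewrite /ratr; set q := _ / _.
apply/eqP; rewrite eqr_div ?padic_intr_eq0 ?padic_natr_eq0 ?denq_neq0 //.
have : (a%:Z * denq q)%:~R == (numq q * b%:Z)%:~R :> rat.
  by rewrite !intrM numqE mulrAC /q mulfVK // pnatr_eq0.
rewrite eqr_int => /eqP e.
by rewrite -[b%:R]/(b%:Z%:~R) -[a%:R]/(a%:Z%:~R) -!intrM e.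
Qed.

Lemma padic_shift_subproof (x : Qp) :
  exists m, `[< exists z : Zp, p%:R ^+ m * x = z%:F >].
Proof.
have [u uu dE] := padic_valP (denom_ratioP (repr x)).
set v := padic_val _ in dE; exists v; apply/asboolP; exists (\n_(repr x) / u).
have u0 : u%:F != 0 :> Qp by rewrite tofrac_eq0; apply: contraTneq uu => ->; rewrite unitr0.
have p0 : p%:R ^+ v != 0 :> Qp.
  by rewrite -(rmorph_nat (@tofrac Zp)) -tofracXn tofrac_eq0 expf_neq0 ?padic_natp_neq0.
rewrite {1}(padic_numden x) dE tofracM tofracXn rmorph_nat invfM mulrCA !mulrA.
rewrite mulfK //; apply: (canLR (mulfK u0)).
by rewrite -tofracM divrK.
Qed.

(* The number of digits of x with negative index. *)
Definition padic_pole (x : Qp) : nat := ex_minn (padic_shift_subproof x).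

Lemma padic_mantissa_subproof (x : Qp) :
  exists z : Zp, p%:R ^+ padic_pole x * x = z%:F.
Proof. by rewrite /padic_pole; case: ex_minnP => m /asboolP. Qed.

Definition padic_mantissa (x : Qp) : Zp := projT1 (cid (padic_mantissa_subproof x)).

(* With m = padic_pole x, the digit of index i - m of x is the digit of index *)
(* i of p^m x.                                                                *)
Definition padic_frac (x : Qp) : rat :=
  let m := padic_pole x in
  \sum_(i < m) (padic_digit (padic_mantissa x) i)%:R * p%:R ^ (i%:Z - m%:Z).

Definition padic_floor (x : Qp) : Zp :=
  padic_series p_pr (fun i => padic_digit (padic_mantissa x) (padic_pole x + i)).

Lemma padic_floor_frac (x : Qp) : x = (padic_floor x)%:F + ratr (padic_frac x).
Proof.
have p0 m : p%:R ^+ m != 0 :> Qp.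
  by rewrite -(rmorph_nat (@tofrac Zp)) -tofracXn tofrac_eq0 expf_neq0 ?padic_natp_neq0.
have q0 m : p%:R ^+ m != 0 :> rat by rewrite expf_neq0 // pnatr_eq0 -lt0n prime_gt0.
rewrite /padic_floor /padic_frac; set M := padic_mantissa x; set m := padic_pole x.
have ME : p%:R ^+ m * x = M%:F by rewrite /M /padic_mantissa; case: cid.
have -> : \sum_(i < m) (padic_digit M i)%:R * p%:R ^ (i%:Z - m%:Z) =
    (padic_res M m)%:R / p%:R ^+ m :> rat.
  rewrite padic_res_digits natr_sum mulr_suml; apply: eq_bigr => i _.
  by rewrite natrM natrX expfzDr ?pnatr_eq0 -?lt0n ?prime_gt0 // exprnN mulrA.
rewrite -natrX ratr_padic_quot; last by rewrite -lt0n expn_gt0 prime_gt0.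
rewrite natrX; apply: (mulfI (p0 m)).
rewrite ME {1}(padic_series_digit M m) tofracD tofracM tofracXn !rmorph_nat.
by rewrite mulrDr mulrCA divff // mulr1 addrC.
Qed.

Definition padic_integers : set Qp := range (fun z : Zp => z%:F).

Definition beta_map (beta : Qp) (x : Zp) : Zp := padic_floor (beta * x%:F).

(* Indexed from 0: beta_digit beta a k is d_{k+1}.                            *)
Definition beta_digit (beta : Qp) (a : Zp) (k : nat) : rat :=
  padic_frac (beta * (iter k (beta_map beta) a)%:F).

Definition beta_finite (beta : Qp) (a : Zp) : Prop :=
  exists N, forall k, (N <= k)%N -> beta_digit beta a k = 0.

Definition Fin (beta : Qp) : set Qp :=
  [set a%:F | a in [set a : Zp | beta_finite beta a]].

End Padic.

Arguments padic_integers {p} p_pr.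

Definition Ap (p : nat) : {pred rat} :=
  fun x => `[< exists m n : int, x = m%:~R * p%:R ^ n >].

Section PisotChabauty.
Context (p : nat) (p_pr : prime p).
Local Notation Qp := (padic p_pr).

Definition Ap_adjoin_inv (beta : Qp) : set Qp :=
  smallest (fun S : set Qp => GRing.subring_closed [in S])
    ([set ratr a | a in [set a | a \in Ap p]] `|` [set beta^-1]).

Definition Ap_poly_unit (f : {poly rat}) : Prop :=
  exists2 g, g \is a polyOver (Ap p) & f * g = 1.

Definition Ap_irreducible (f : {poly rat}) : Prop :=
  [/\ f != 0, ~ Ap_poly_unit f &
      forall g h, g \is a polyOver (Ap p) -> h \is a polyOver (Ap p) ->
        f = g * h -> Ap_poly_unit g \/ Ap_poly_unit h].

Definition is_minpoly (f : {poly rat}) (alpha : Qp) : Prop :=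
  [/\ f \is a polyOver (Ap p), f \is monic, Ap_irreducible f &
      root (map_poly ratr f) alpha].

Context (R : realType) (K : fieldType) (iota : {rmorphism Qp -> K}).

Definition extends_padic_norm (absK : K -> R) : Prop :=
  [/\ forall x, 0 <= absK x /\ (absK x = 0 <-> x = 0),
      forall x y, absK (x * y) = absK x * absK y,
      forall x y, absK (x + y) <= Num.max (absK x) (absK y) &
      forall x : Qp, absK (iota x) = ratr (padic_norm x)].

Definition is_PC (absK : K -> R) (alpha : Qp) : Prop :=
  exists f : {poly rat},
    [/\ is_minpoly f alpha,
        1 < padic_norm alpha,
        forall x : K, root (map_poly ratr f) x -> x != iota alpha -> absK x <= 1 &
        forall z : R[i], root (map_poly ratr f) z -> `|z| < 1].

End PisotChabauty.

Section SRS.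
Context (R : realType) (n : nat).

(* insub i.+1 is the index following i, and is None at the last index.        *)
Definition srs_map (r : 'rV[R]_n) (z : 'rV[int]_n) : 'rV[int]_n :=
  \row_(i < n)
    if insub i.+1 is Some j then z 0 j
    else - Num.floor (\sum_j r 0 j * (z 0 j)%:~R).

Definition srs_D0 : set 'rV[R]_n :=
  [set r | forall z, exists2 k, (0 < k)%N & iter k (srs_map r) z = 0].

End SRS.

Arguments srs_D0 : clear implicits.

(* The a_i of f = x^n - a_1 x^(n-1) - ... - a_n, where n is the degree of f.   *)
Definition minpoly_coef (f : {poly rat}) (i : nat) : rat := - f`_((size f).-1 - i).

(* (a_n, ..., a_1)                                                            *)
Definition minpoly_vec (R : realType) (f : {poly rat}) : 'rV[R]_(size f).-1 :=
  \row_(j < (size f).-1) ratr (minpoly_coef f ((size f).-1 - j)).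

(* Main.v *)
(* Let w_0 = 1 and w_i = beta w_(i-1) - a_i, so that w_n = 0 and A_p[beta] is  *)
(* spanned by w_0, ..., w_(n-1).  If max_(i >= 2) |a_i| < |a_1|, then           *)
(* |w_i| < 1 for i >= 1: an element sum y_i w_i with y_1, ..., y_(n-1) in Z is  *)
(* in Z_p iff y_0 is in Z, so on integral coordinates T is the shift radix      *)
(* system of -a, and every orbit starting in A_p[1/beta] becomes integral.      *)
(*                                                                              *)
(* Conversely, assume Fin(beta) = A_p[1/beta] \cap Z_p.  The expansion of 1     *)
(* gives a monic P over A_p with P = (X - beta) Q, Q monic over Z_p, so the     *)
(* other conjugates have absolute value at most 1.  Expansions of well-chosen   *)
(* elements, read at another conjugate, exclude absolute value 1 (take          *)
(* p^(-k) beta^(-2), whose conjugate would be too large for the digits) and     *)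
(* complex absolute value > 1 (take a large integer).  Hence the other p-adic   *)
(* conjugates are < 1, which is dominance of a_1, and the first part yields     *)
(* -a in D_n^0.  A complex conjugate of absolute value 1 would make the minimal *)
(* polynomial self-reciprocal up to sign, so a_n = 1 or -1; but then 0 is its   *)
(* own only preimage under the shift radix system.                              *)

Require Import Defs.
From HB Require Import structures.
From mathcomp Require Import all_boot all_order all_algebra.
From mathcomp Require Import fraction complex.
From mathcomp Require Import all_classical reals.
From mathcomp Require Import ring lra zify.

Set Implicit Arguments.
Unset Strict Implicit.
Unset Printing Implicit Defensive.

Import Order.TTheory GRing.Theory Num.Theory.

Local Open Scope ring_scope.
Local Open Scope classical_set_scope.

(** In the coordinates w_0, ..., w_(n-1), multiplication by beta shifts the coordinates and creates
    one new one ([quot_comb_step]), from which T subtracts a digit in [0, 1). Since Z[1/p] and Z_p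
    meet in Z ([Ap_padic_integer]) and dominance makes w_1, ..., w_(n-1) small ([quot_basis_lt1]),
    integral coordinates stay integral, so the new one is a real floor. This is how the p-adic map T
    becomes a shift radix system ([quot_comb_int], [beta_map_srs]). Other coordinates lose a factor
    p every n steps ([quot_comb_contract]), which yields [srs_D0_Fin]; linear independence of the
    w_i yields the converse [Fin_srs_D0].

    Finiteness acts on conjugates through [Fin_relation]: a finite expansion of c beta^(-j) is a
    polynomial relation over A_p, valid at every conjugate, with digits bounded both p-adically and
    in R. Together with the cofactor of the expansion of 1 ([cofactor_root_le1]) it gives the p-adic
    bounds, then dominance ([annihilator_dominant]), then -a in D_n^0. Only this last fact makes the
    complex bound strict ([archimedean_root_lt1]). *)

(** * The ring Z[1/p] *)

Lemma ApP (p : nat) (x : rat) :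
  reflect (exists (m : int) (k : nat), x = m%:~R / p%:R ^+ k) (x \in Ap p).
Proof.
apply: (iffP idP) => [/asboolP[m [[k|k] ->]]|[m [k ->]]].
- by exists (m * p%:Z ^+ k), 0%N; rewrite expr0 divr1 intrM rmorphXn.
- by exists m, k.+1.
- by apply/asboolP; exists m, (- k%:Z); rewrite exprnN.
Qed.

Fact Ap_subring (p : nat) : subring_closed (Ap p).
Proof.
split=> [|x y|x y].
- by apply/ApP; exists 1, 0%N; rewrite divr1.
- move=> /ApP[m [k ->]] /ApP[n [l ->]]; apply/ApP.
  (* At p = 0 a fraction with positive exponent is m / 0 = 0, so both terms are integers. *)
  have [->|p0] := eqVneq p 0%N.
    exists ((if k is 0 then m else 0) - (if l is 0 then n else 0)), 0%N.
    by case: k; case: l => *; rewrite !expr0n intrB /= ?divr1 ?invr0 ?mulr0.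
  exists (m * p%:Z ^+ l - n * p%:Z ^+ k), (k + l)%N.
  have q0 j : p%:R ^+ j != 0 :> rat by rewrite expf_neq0 // pnatr_eq0.
  by rewrite intrB !intrM !rmorphXn /= exprD; field; rewrite !q0.
- move=> /ApP[m [k ->]] /ApP[n [l ->]]; apply/ApP; exists (m * n), (k + l)%N.
  by rewrite intrM exprD invfM mulrACA.
Qed.
HB.instance Definition _ (p : nat) :=
  GRing.isSubringClosed.Build rat (Ap p) (Ap_subring p).

(** * Ultrametric absolute values *)

(** Serves both the absolute value of Q_p, with values in [rat], and its extension to K, with values
    in R. *)
Record ultrametric (F : fieldType) (R : realFieldType) (abs : F -> R) : Prop := {
  um_ge0 : forall x, 0 <= abs x;
  um_eq0 : forall x, (abs x == 0) = (x == 0);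
  umM : {morph abs : x y / x * y};
  umD : forall x y, abs (x + y) <= Num.max (abs x) (abs y) }.

Section Ultrametric.
Context (F : fieldType) (R : realFieldType) (abs : F -> R).
Hypothesis um : ultrametric abs.
Implicit Types (x y : F) (c : R).

Lemma um0 : abs 0 = 0.
Proof. by apply/eqP; rewrite um_eq0. Qed.

Lemma um_gt0 x : (0 < abs x) = (x != 0).
Proof. by rewrite lt_def um_eq0 // um_ge0 ?andbT. Qed.

Lemma um1 : abs 1 = 1.
Proof.
have a0 : abs 1 != 0 by rewrite um_eq0 ?oner_neq0.
by apply: (mulfI a0); rewrite -(umM um) !mulr1.
Qed.

Lemma umX n : {morph abs : x / x ^+ n}.
Proof.
by move=> x; elim: n => [|n IH]; rewrite ?expr0 ?um1 // !exprS (umM um) IH.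
Qed.

Lemma umV : {morph abs : x / x^-1}.
Proof.
move=> x; have [->|x0] := eqVneq x 0; first by rewrite invr0 um0 invr0.
have a0 : abs x != 0 by rewrite um_eq0.
by apply: (mulfI a0); rewrite -(umM um) !divff // um1.
Qed.

Lemma umN x : abs (- x) = abs x.
Proof.
suff e : abs (-1) = 1 by rewrite -mulN1r (umM um) e mul1r.
apply/eqP; rewrite -(@eqrXn2 _ 2) ?ler01 ?um_ge0 // -umX sqrrN !expr1n.
by rewrite um1.
Qed.

Lemma umD_le c x y : abs x <= c -> abs y <= c -> abs (x + y) <= c.
Proof. by move=> xc yc; apply: le_trans (umD um x y) _; rewrite ge_max xc. Qed.

Lemma umD_lt c x y : abs x < c -> abs y < c -> abs (x + y) < c.
Proof. by move=> xc yc; apply: le_lt_trans (umD um x y) _; rewrite gt_max xc. Qed.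

Lemma umB_le c x y : abs x <= c -> abs y <= c -> abs (x - y) <= c.
Proof. by move=> xc yc; apply: umD_le; rewrite ?umN. Qed.

Lemma umB_lt c x y : abs x < c -> abs y < c -> abs (x - y) < c.
Proof. by move=> xc yc; apply: umD_lt; rewrite ?umN. Qed.

Lemma umDl x y : abs y < abs x -> abs (x + y) = abs x.
Proof.
move=> yx; apply/eqP; rewrite eq_le umD_le ?(ltW yx) //= leNgt; apply/negP => h.
by have := umB_lt h yx; rewrite addrK ltxx.
Qed.

Lemma um_sum_le (I : Type) (r : seq I) (P : pred I) (E : I -> F) c :
  0 <= c -> (forall i, P i -> abs (E i) <= c) -> abs (\sum_(i <- r | P i) E i) <= c.
Proof.
move=> c0 Ec; elim/big_ind: _ => // [|x y]; first by rewrite um0.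
exact: umD_le.
Qed.

Lemma um_prod_XsubC_coef (s : seq F) i : all (fun a => abs a < 1) s ->
  (i < size s)%N -> abs (\prod_(a <- s) ('X - a%:P))`_i < 1.
Proof.
elim: s i => // a s IH i /= /andP[a1 s1]; rewrite ltnS big_cons mulrBl coefB.
set q := \prod_(b <- s) _ in IH * => is1.
(* The product by X - a also involves the leading coefficient 1 of q, hence a weak bound on all
   coefficients. *)
have q1 j : abs q`_j <= 1.
  have [js|js] := ltnP j (size s); first exact/ltW/IH.
  have sq : size q = (size s).+1 by rewrite size_prod_XsubC.
  have mq : q \is monic by rewrite monic_prod_XsubC.
  have [->|nj] := eqVneq j (size s).
    by move/monicP: mq; rewrite lead_coefE sq /= => ->; rewrite um1.
  by rewrite nth_default ?um0 // sq ltn_neqAle eq_sym nj.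
rewrite mul_polyC coefZ; apply: umB_lt; last first.
  by rewrite (umM um); apply: le_lt_trans a1; rewrite ler_piMr ?um_ge0.
rewrite coefXM; case: i is1 => [|i] is1 /=; first by rewrite um0.
by apply: IH.
Qed.

End Ultrametric.

(** * The embedding of Q into a field of characteristic 0 *)

Section RatrChar0.
Context (F : fieldType) (intr_eq0F : forall k : int, (k%:~R == 0 :> F) = (k == 0)).

Let d0 z : (denq z)%:~R != 0 :> F. Proof. by rewrite intr_eq0F denq_neq0. Qed.

Lemma ratr_char0_zmod : zmod_morphism (@ratr F).
Proof.
move=> x y; rewrite /ratr.
have : (numq (x - y) * (denq x * denq y) =
        (numq x * denq y - numq y * denq x) * denq (x - y))%R.
  by apply: (@intr_inj rat); rewrite !(intrM, intrB) !numqE; ring.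
move/(congr1 (fun z => z%:~R : F)); rewrite !(intrM, intrB) => e.
apply: (mulIf (mulf_neq0 (d0 (x - y)) (mulf_neq0 (d0 x) (d0 y)))).
by rewrite [LHS]mulrA mulfVK ?d0 // e; field; rewrite !d0.
Qed.

Lemma ratr_char0_monoid : monoid_morphism (@ratr F).
Proof.
split=> [|x y]; first by rewrite -[1]/(1%:~R) ratr_int.
rewrite /ratr.
have : (numq (x * y) * (denq x * denq y) = (numq x * numq y) * denq (x * y))%R.
  by apply: (@intr_inj rat); rewrite !intrM !numqE; ring.
move/(congr1 (fun z => z%:~R : F)); rewrite !intrM => e.
apply: (mulIf (mulf_neq0 (d0 (x * y)) (mulf_neq0 (d0 x) (d0 y)))).
by rewrite [LHS]mulrA mulfVK ?d0 // e; field; rewrite !d0.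
Qed.

End RatrChar0.

(** * The absolute value of Q_p *)

Section PadicNorm.
Context (p : nat) (p_pr : prime p).
Local Notation Zp := (padic_int p_pr).
Local Notation Qp := (padic p_pr).

Lemma padic_norm_ultrametric : ultrametric (@padic_norm p p_pr).
Proof.
split; [exact: padic_norm_ge0|exact: padic_norm_eq0|exact: padic_normM|].
exact: padic_normD.
Qed.
Local Notation um := padic_norm_ultrametric.

(* The library makes ratr a ring morphism only into number fields. *)
Definition rat_padic (x : rat) : Qp := ratr x.

HB.instance Definition _ := GRing.isZmodMorphism.Build rat Qp rat_padic
  (ratr_char0_zmod (@padic_intr_eq0 p p_pr)).
HB.instance Definition _ := GRing.isMonoidMorphism.Build rat Qp rat_padic
  (ratr_char0_monoid (@padic_intr_eq0 p p_pr)).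

Lemma ratr_padicE : @ratr Qp = rat_padic.
Proof. by []. Qed.

Lemma padic_norm_tofrac_le1 (z : Zp) : padic_norm z%:F <= 1.
Proof. by apply/padic_norm_le1; exists z. Qed.

Lemma padic_norm_int_le1 (m : int) : padic_norm (m%:~R : Qp) <= 1.
Proof. by apply/padic_norm_le1; exists m%:~R; rewrite rmorph_int. Qed.

Let p_gt0 : 0 < p%:R :> rat. Proof. by rewrite ltr0n prime_gt0. Qed.
Let p_gt1 : 1 < p%:R :> rat. Proof. by rewrite ltr1n prime_gt1. Qed.

Lemma padic_norm_le1_exp (x : Qp) : padic_norm x <= 1 -> x != 0 ->
  exists k, padic_norm x = p%:R ^- k.
Proof.
move=> /padic_norm_le1[z ->]; rewrite tofrac_eq0 => z0.
by exists (padic_val z); rewrite padic_norm_tofrac /padic_int_norm (negbTE z0).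
Qed.

(** The value group is discrete; this gap provides the factor p gained in [quot_comb_contract]. *)
Lemma padic_norm_lt1 (x : Qp) : padic_norm x < 1 -> padic_norm x <= p%:R^-1.
Proof.
have [->|x0] := eqVneq x 0; first by rewrite (um0 um) invr_ge0 ltW.
move=> x1; have [k e] := padic_norm_le1_exp (ltW x1) x0; rewrite {}e in x1 *.
case: k x1 => [|k _]; first by rewrite expr0 invr1 ltxx.
by rewrite exprS invfM ler_piMr ?invr_ge0 ?(ltW p_gt0) // invf_le1 ?exprn_gt0 // exprn_ege1 // ltW.
Qed.

Lemma padic_norm_gt1_exp (x : Qp) : 1 < padic_norm x ->
  exists k, padic_norm x = p%:R ^+ k.+1.
Proof.
move=> x1; have x0 : x != 0 by rewrite -(um_gt0 um) (lt_trans ltr01).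
have xV : padic_norm x^-1 < 1 by rewrite (umV um) invf_lt1 // (um_gt0 um).
have [|k e] := padic_norm_le1_exp (ltW xV); first by rewrite invr_eq0.
case: k e => [|k] e; first by rewrite e expr0 invr1 ltxx in xV.
by exists k; apply: invr_inj; rewrite -(umV um) e.
Qed.

(** If m / p^k is in Z_p, reduction modulo p^k shows that p^k divides m. *)
Lemma Ap_padic_integer (x : rat) :
  x \in Ap p -> padic_norm (ratr x : Qp) <= 1 -> x \is a Num.int.
Proof.
move=> /ApP[m [k ->]]; rewrite ratr_padicE fmorph_div rmorphXn /= rmorph_nat rmorph_int.
move=> /padic_norm_le1[z e].
have pk0 : p%:R ^+ k != 0 :> Qp.
  by rewrite -natrX padic_natr_eq0 -lt0n expn_gt0 prime_gt0.
have {}e : m%:~R = p%:R ^+ k * z :> Zp.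
  apply/eqP; rewrite -tofrac_eq rmorph_int tofracM tofracXn rmorph_nat -e.
  by rewrite mulrCA divff ?mulr1.
have : exists w : Zp, (absz m)%:R = p%:R ^+ k * w.
  case: m e => m e; first by exists z.
  by exists (- z); rewrite mulrN -e NegzE mulrNz opprK.
move=> [w /(congr1 (fun x => padic_res x k))].
rewrite padic_res_mul -natrX !padic_res_natr modnn mul0n mod0n => /eqP.
rewrite -/(dvdn _ _) => /dvdnP[q mE].
apply/intrP; exists ((-1) ^+ (m < 0)%R * q%:Z).
have q0 : p%:R ^+ k != 0 :> rat by rewrite expf_neq0 // gt_eqF.
apply: (canLR (mulfK q0)).
rewrite {1}[m]intEsign mE !intrM PoszM intrM -!pmulrn natrX mulrA //.
Qed.

End PadicNorm.

(** * Digit sums as polynomials *)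

Section DigitSum.
Variable A : comNzRingType.
Implicit Types (d t : nat -> A) (x b : A) (N : nat).

(** Horner form of d_0 x^(N-1) + ... + d_(N-1): the leading digit comes first, as in a
    beta-expansion. *)
Fixpoint digit_sum d N x : A :=
  if N is N'.+1 then digit_sum d N' x * x + d N' else 0.

(* Synthetic division by x - b, with quotient t and successive remainders t k. *)
Lemma digit_sum_div d t x b N : (forall k, b * t k = d k + t k.+1) ->
  (x - b) * digit_sum t N x = t 0%N * x ^+ N - digit_sum d N x - t N.
Proof.
move=> bt; elim: N => [|N IH] /=; first by rewrite mulr0 expr0 mulr1 subr0 subrr.
have -> : t N.+1 = b * t N - d N by rewrite bt addrC addKr.
by rewrite mulrDr mulrA IH exprSr; ring.
Qed.

End DigitSum.

Definition digit_poly (A : comNzRingType) (d : nat -> A) N : {poly A} :=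
  digit_sum (polyC \o d) N 'X.

Lemma digit_poly_over (A : comNzRingType) (S : subringClosed A) d N :
  (forall k, d k \in S) -> digit_poly d N \is a polyOver S.
Proof.
move=> dS; rewrite /digit_poly; elim: N => [|N IH] /=; first exact: rpred0.
by rewrite rpredD ?rpredM ?polyOverX ?polyOverC.
Qed.

Lemma size_digit_poly (A : comNzRingType) (d : nat -> A) N :
  (size (digit_poly d N) <= N)%N.
Proof.
rewrite /digit_poly; elim: N => [|N IH] /=; first by rewrite size_poly0.
by rewrite size_MXaddC; case: ifP.
Qed.

Lemma map_digit_poly (A B : comNzRingType) (f : {rmorphism A -> B}) d N :
  map_poly f (digit_poly d N) = digit_poly (f \o d) N.
Proof.
rewrite /digit_poly; elim: N => [|N IH] /=; first by rewrite rmorph0.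
by rewrite rmorphD rmorphM /= map_polyX map_polyC IH.
Qed.

Lemma horner_digit_poly (A : comNzRingType) (d : nat -> A) N x :
  (digit_poly d N).[x] = digit_sum d N x.
Proof.
rewrite /digit_poly; elim: N => [|N IH] /=; first by rewrite horner0.
by rewrite hornerMXaddC IH.
Qed.

Lemma horner_map_digit_poly (A B : comNzRingType) (f : {rmorphism A -> B}) d N x :
  (map_poly f (digit_poly d N)).[x] = digit_sum (f \o d) N x.
Proof. by rewrite map_digit_poly horner_digit_poly. Qed.

Section UltrametricDigitSum.
Context (F : fieldType) (R : realFieldType) (abs : F -> R).
Hypothesis um : ultrametric abs.

Lemma um_digit_sum_le (d : nat -> F) N x c :
  0 <= c -> abs x <= 1 -> (forall k, abs (d k) <= c) -> abs (digit_sum d N x) <= c.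
Proof.
move=> c0 x1 dc; elim: N => [|N IH] /=; first by rewrite (um0 um).
by rewrite (umD_le um) // (umM um) (le_trans _ IH) // ler_piMr ?(um_ge0 um).
Qed.

(** The leading term strictly dominates, so such a sum has no zero outside the unit disc. *)
Lemma um_digit_sum_monic (t : nat -> F) N x :
  1 < abs x -> t 0%N = 1 -> (forall k, abs (t k) <= 1) ->
  abs (digit_sum t N.+1 x) = abs x ^+ N.
Proof.
move=> x1 t0 t1; elim: N => [|N IH]; first by rewrite /= mul0r add0r t0 (um1 um).
rewrite [digit_sum _ _ _]/(digit_sum t N.+1 x * x + t N.+1).
by rewrite (umDl um) (umM um) IH -exprSr // (le_lt_trans (t1 _)) // exprn_egt1.
Qed.

End UltrametricDigitSum.

(** The geometric series bound, multiplied by |x| - 1 to avoid a division. *)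
Lemma norm_digit_sum_le (C : numDomainType) (d : nat -> C) N x :
  1 <= `|x| -> (forall k, `|d k| <= 1) ->
  `|digit_sum d N x| * (`|x| - 1) <= `|x| ^+ N - 1.
Proof.
move=> x1 d1; elim: N => [|N IH] /=; first by rewrite normr0 mul0r expr0 subrr.
have x0 : 0 <= `|x| - 1 by rewrite subr_ge0.
apply: le_trans (_ : (`|digit_sum d N x| * `|x| + 1) * (`|x| - 1) <= _).
  by rewrite ler_wpM2r // (le_trans (ler_normD _ _)) // normrM lerD2l.
have := ler_wpM2r (normr_ge0 x) IH; rewrite -subr_ge0 => h.
rewrite -subr_ge0 exprSr; apply: le_trans h _; rewrite le_eqVlt; apply/orP; left.
by apply/eqP; ring.
Qed.

(** * Beta-expansions and A_p[1/beta] *)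

Section BetaExpansion.
Context (p : nat) (p_pr : prime p).
Local Notation Zp := (padic_int p_pr).
Local Notation Qp := (padic p_pr).
Local Notation um := (padic_norm_ultrametric p_pr).

Let p_gt0 : 0 < p%:R :> rat. Proof. by rewrite ltr0n prime_gt0. Qed.

Lemma padic_fracE (x : Qp) :
  padic_frac x =
  (padic_res (padic_mantissa x) (padic_pole x))%:R / p%:R ^+ padic_pole x.
Proof.
rewrite /padic_frac padic_res_digits natr_sum mulr_suml; apply: eq_bigr => i _.
by rewrite natrM natrX expfzDr ?gt_eqF // exprnN mulrA.
Qed.

Lemma padic_frac_Ap (x : Qp) : padic_frac x \in Ap p.
Proof.
by rewrite padic_fracE; apply/ApP; exists (padic_res (padic_mantissa x) (padic_pole x))%:Z,
  (padic_pole x); rewrite -pmulrn.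
Qed.

Lemma padic_frac_ge0 (x : Qp) : 0 <= padic_frac x.
Proof. by rewrite padic_fracE divr_ge0 // exprn_ge0 // ltW. Qed.

Lemma padic_frac_lt1 (x : Qp) : padic_frac x < 1.
Proof.
rewrite padic_fracE ltr_pdivrMr ?exprn_gt0 // mul1r -natrX ltr_nat.
by rewrite -padic_res_mod ltn_mod expn_gt0 prime_gt0.
Qed.

Lemma Ap_int_small (q : rat) : q \in Ap p -> padic_norm (ratr q : Qp) <= 1 ->
  `|q| < 1 -> q = 0.
Proof.
move=> qA /(Ap_padic_integer qA)/intrP[m ->].
by rewrite -intr_norm -[1]/(1%:~R) ltr_int; case: m => [[|m]|m].
Qed.

(** Two candidates differ by an element of Z[1/p] in Z_p, that is, an integer, of real absolute
    value less than 1. *)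
Lemma padic_frac_uniq (x : Qp) (z : Zp) (q : rat) :
  q \in Ap p -> 0 <= q < 1 -> x = z%:F + ratr q -> padic_frac x = q.
Proof.
move=> qA /andP[q0 q1] xE; apply/eqP; rewrite -subr_eq0; apply/eqP.
apply: Ap_int_small; first by rewrite rpredB ?padic_frac_Ap.
  rewrite ratr_padicE rmorphB /=.
  have -> : rat_padic p_pr (padic_frac x) - rat_padic p_pr q = (z - padic_floor x)%:F.
    have := padic_floor_frac x; rewrite {1}xE tofracB /rat_padic => e.
    by apply/eqP; rewrite subr_eq -addrA [_ + ratr q]addrC addrA e addrAC subrr add0r.
  exact: padic_norm_tofrac_le1.
have := padic_frac_ge0 x; have := padic_frac_lt1 x.
by rewrite ltr_norml => *; apply/andP; split; lra.
Qed.

Lemma padic_frac0 : padic_frac (0 : Qp) = 0.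
Proof.
apply: (@padic_frac_uniq _ 0); rewrite ?rpred0 ?lexx ?ltr01 //.
by rewrite tofrac0 ratr_padicE rmorph0 addr0.
Qed.

Lemma padic_floor0 : padic_floor (0 : Qp) = 0.
Proof.
have := padic_floor_frac (0 : Qp).
rewrite padic_frac0 ratr_padicE rmorph0 addr0 -tofrac0 => /eqP.
by rewrite tofrac_eq => /eqP.
Qed.

Context (beta : Qp) (beta_gt1 : 1 < padic_norm beta).

Definition beta_orbit (a : Zp) (k : nat) : Qp := (iter k (beta_map beta) a)%:F.

Lemma beta_orbitS a k :
  beta * beta_orbit a k = ratr (beta_digit beta a k) + beta_orbit a k.+1.
Proof.
rewrite {1}(padic_floor_frac (beta * _)) addrC; congr (_ + _).
Qed.

Lemma beta_orbit_le1 a k : padic_norm (beta_orbit a k) <= 1.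
Proof. exact: padic_norm_tofrac_le1. Qed.

Lemma beta_digit_Ap a k : beta_digit beta a k \in Ap p.
Proof. exact: padic_frac_Ap. Qed.

Lemma beta_digit_norm a k : padic_norm (ratr (beta_digit beta a k) : Qp) <= padic_norm beta.
Proof.
have -> : ratr (beta_digit beta a k) = beta * beta_orbit a k - beta_orbit a k.+1.
  by rewrite beta_orbitS addrK.
apply: (umB_le um); last exact: le_trans (beta_orbit_le1 _ _) (ltW beta_gt1).
by rewrite (umM um) ler_piMr ?(um_ge0 um) ?beta_orbit_le1.
Qed.

Lemma beta_map0 : beta_map beta 0 = 0.
Proof. by rewrite /beta_map tofrac0 mulr0 padic_floor0. Qed.

Lemma iter_beta_map0 k : iter k (beta_map beta) 0 = 0.
Proof. by elim: k => // k IH; rewrite iterS IH beta_map0. Qed.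

(* If the digits vanish from index N on, the orbit grows like beta ^ k there,  *)
(* so it can stay in Z_p only by being 0.                                      *)
Lemma beta_finiteP a : beta_finite beta a <-> exists M, iter M (beta_map beta) a = 0.
Proof.
split=> [[N dN]|[M aM]]; last first.
  exists M => k /subnK <-; rewrite /beta_digit iterD aM iter_beta_map0.
  by rewrite tofrac0 mulr0 padic_frac0.
exists N; apply/eqP; rewrite -(tofrac_eq0 (iter N _ a)) -/(beta_orbit a N).
apply/negPn/negP => x0.
have grow k : beta_orbit a (k + N) = beta ^+ k * beta_orbit a N.
  elim: k => [|k IH]; first by rewrite mul1r.
  rewrite exprS -mulrA -IH beta_orbitS dN ?leq_addl // ratr_padicE.
  by rewrite rmorph0 add0r.
have px0 : 0 < padic_norm (beta_orbit a N) by rewrite (um_gt0 um).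
have := beta_orbit_le1 a (Num.bound (padic_norm (beta_orbit a N))^-1 + N).
set m := Num.bound _; rewrite grow (umM um) (umX um) -ler_pdivlMr // div1r leNgt.
suff -> : (padic_norm (beta_orbit a N))^-1 < padic_norm beta ^+ m by [].
have [k bE] := padic_norm_gt1_exp beta_gt1.
apply: lt_le_trans (archi_boundP _) _; first by rewrite invr_ge0 ltW.
rewrite -/m bE -exprM -natrX ler_nat ltnW // (leq_trans (ltn_expl m (prime_gt1 p_pr))) //.
by rewrite leq_exp2l ?prime_gt1 // mulSn leq_addr.
Qed.

Lemma FinP (x : Qp) :
  Fin beta x <-> exists2 a : Zp, x = a%:F & exists M, iter M (beta_map beta) a = 0.
Proof.
split=> [[a /beta_finiteP aM <-]|[a -> /beta_finiteP aM]]; [by exists a|by exists a].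
Qed.

Lemma Ap_adjoin_invP (x : Qp) :
  (forall S : set Qp, subring_closed [in S] -> (forall a, a \in Ap p -> S (ratr a)) ->
    S beta^-1 -> S x) <-> Ap_adjoin_inv beta x.
Proof.
split=> [h S [Sr ApS]|h S Sr SA Sb].
  by apply: h => // [a aA|]; apply: ApS; [left; exists a|right].
by apply: h; split=> // y [[a aA <-]|->]; [apply: SA|].
Qed.

Lemma Ap_adjoin_inv_subring : subring_closed [in Ap_adjoin_inv beta].
Proof.
split=> [|x y|x y].
- by rewrite inE; apply/Ap_adjoin_invP => S [S1 _ _] _ _; rewrite inE in S1.
- rewrite !inE => /Ap_adjoin_invP Sx /Ap_adjoin_invP Sy.
  apply/Ap_adjoin_invP => S Sr SA Sb; case: (Sr) => _ SB _.
  by have := SB x y; rewrite !inE; apply; [apply: Sx|apply: Sy].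
- rewrite !inE => /Ap_adjoin_invP Sx /Ap_adjoin_invP Sy.
  apply/Ap_adjoin_invP => S Sr SA Sb; case: (Sr) => _ _ SM.
  by have := SM x y; rewrite !inE; apply; [apply: Sx|apply: Sy].
Qed.

Lemma Ap_adjoin_inv_ratr a : a \in Ap p -> Ap_adjoin_inv beta (ratr a).
Proof. by move=> aA; apply/Ap_adjoin_invP => S _ + _; apply. Qed.

Lemma Ap_adjoin_inv0 : Ap_adjoin_inv beta 0.
Proof.
by have [+ _] := GRing.subring_closedB Ap_adjoin_inv_subring; rewrite inE.
Qed.

Lemma Ap_adjoin_inv_inv : Ap_adjoin_inv beta beta^-1.
Proof. by apply/Ap_adjoin_invP. Qed.

Lemma Ap_adjoin_invD x y :
  Ap_adjoin_inv beta x -> Ap_adjoin_inv beta y -> Ap_adjoin_inv beta (x + y).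
Proof.
have [_ SD] := GRing.subring_closed_semi Ap_adjoin_inv_subring => Sx Sy.
have [+ _] := GRing.subring_closed_semi Ap_adjoin_inv_subring.
by move=> [_ /(_ x y)]; rewrite !inE; apply.
Qed.

Lemma Ap_adjoin_invM x y :
  Ap_adjoin_inv beta x -> Ap_adjoin_inv beta y -> Ap_adjoin_inv beta (x * y).
Proof.
have [_ _ SM] := Ap_adjoin_inv_subring => Sx Sy.
by have := SM x y; rewrite !inE; apply.
Qed.

Lemma Ap_adjoin_invX x k : Ap_adjoin_inv beta x -> Ap_adjoin_inv beta (x ^+ k).
Proof.
move=> Sx; elim: k => [|k IH]; last by rewrite exprS; apply: Ap_adjoin_invM.
by have [+ _ _] := Ap_adjoin_inv_subring; rewrite inE.
Qed.

Let beta0 : beta != 0.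
Proof. by rewrite -(um_gt0 um) (lt_trans ltr01). Qed.

(** Running the orbit backwards from 0, each step adds a digit and divides by beta. *)
Lemma Fin_sub_Ap_adjoin_inv : Fin beta `<=` Ap_adjoin_inv beta `&` padic_integers p_pr.
Proof.
move=> _ /FinP[a -> [M aM]]; split; last by exists a.
elim: M a aM => [|M IH] a /= aM.
  by rewrite aM tofrac0; apply: Ap_adjoin_inv0.
have -> : a%:F = beta^-1 * (ratr (beta_digit beta a 0) + beta_orbit a 1).
  by rewrite -beta_orbitS mulKf.
apply: Ap_adjoin_invM; first exact: Ap_adjoin_inv_inv.
apply: Ap_adjoin_invD; first exact: (Ap_adjoin_inv_ratr (beta_digit_Ap _ _)).
by apply: IH; rewrite -iterSr.
Qed.

End BetaExpansion.

(** * Minimal polynomials over a field and over Z[1/p] *)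

(** The minimal polynomial of b over L; divisibility is the form that transfers relations from b to
    its conjugates. *)
Definition generates_annihilator (L F : fieldType) (phi : {rmorphism L -> F})
    (b : F) (f : {poly L}) : Prop :=
  [/\ f \is monic, root (map_poly phi f) b &
      forall g, root (map_poly phi g) b -> f %| g].

Section Annihilator.
Context (L F : fieldType) (phi : {rmorphism L -> F}) (b : F).

Lemma generates_annihilator_exists (P : {poly L}) : P != 0 ->
  root (map_poly phi P) b -> exists f, generates_annihilator phi b f.
Proof.
move=> P0 Pb.
have ex : exists n, `[< exists g : {poly L},
    [/\ g != 0, root (map_poly phi g) b & size g = n] >].
  by exists (size P); apply/asboolP; exists P.
case: (ex_minnP ex) => n /asboolP[g [g0 gb gn]] nmin.
have lc0 : lead_coef g != 0 by rewrite lead_coef_eq0.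
exists ((lead_coef g)^-1 *: g); split.
- by rewrite monicE lead_coefZ mulVf.
- by rewrite map_polyZ /= rootZ // fmorph_eq0 invr_eq0.
move=> h hb; rewrite dvdpZl ?invr_eq0 // /dvdp; apply: contraLR hb => r0.
rewrite (divp_eq h g) rmorphD rmorphM /= /root hornerD hornerM (rootP gb) mulr0 add0r.
apply/negP => rb; have := nmin (size (h %% g)).
rewrite leqNgt -gn ltn_modp g0 => /(_ _)/negP; apply; last by [].
by apply/asboolP; exists (h %% g).
Qed.

Context (f : {poly L}) (fP : generates_annihilator phi b f).

Lemma annihilator_size_gt1 : (1 < size f)%N.
Proof.
have [fm fb _] := fP; rewrite -(size_map_poly phi); apply: root_size_gt1 fb.
by rewrite map_poly_eq0 monic_neq0.
Qed.

(** Write f = q d with d the gcd: b is a root of q or of d, and f divides that factor. *)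
Lemma annihilator_coprime g : f %| g \/ coprimep f g.
Proof.
have [fm fb fmin] := fP; have f0 := monic_neq0 fm.
have := divpK (dvdp_gcdl f g); set d := gcdp f g; set q := f %/ d => dE.
have : root (map_poly phi (q * d)) b by rewrite dE.
rewrite rmorphM rootM => /orP[/fmin h|/fmin h]; last first.
  by left; apply: dvdp_trans h (dvdp_gcdr _ _).
right; rewrite coprimep_def -/d.
have d0 : d != 0 by rewrite gcdp_eq0 negb_and f0.
have q0 : q != 0 by apply: contra_neq f0 => q0; rewrite -dE q0 mul0r.
have := dvdp_leq q0 h.
have : size f = (size q + size d).-1 by rewrite -dE size_mul.
move: d0 q0; rewrite -!size_poly_gt0.
move: (size d) (size q) (size f) => sd sq sf *; lia.
Qed.

Lemma annihilator_factor : exists g : {poly F},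
  [/\ map_poly phi f = ('X - b%:P) * g, g \is monic & size g = (size f).-1].
Proof.
have [fm fb _] := fP; have [g gE] := factor_theorem _ _ fb; exists g.
have fM : map_poly phi f \is monic by rewrite map_monic.
have gM : g \is monic by rewrite gE monicMr ?monicXsubC in fM.
split=> //; first by rewrite mulrC.
rewrite -(size_map_poly phi) gE size_Mmonic ?monic_neq0 ?monicXsubC //.
by rewrite size_XsubC addn2.
Qed.

End Annihilator.

Lemma polyOver_Ap_scale (p : nat) (P : {poly rat}) : prime p -> P \is a polyOver (Ap p) ->
  exists N (Q : {poly int}), p%:R ^+ N *: P = map_poly intr Q.
Proof.
move=> p_pr /polyOverP PA; have q0 j : p%:R ^+ j != 0 :> rat.
  by rewrite expf_neq0 // pnatr_eq0 -lt0n prime_gt0.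
have /choice[k kP] : forall i, exists k, p%:R ^+ k * P`_i \is a Num.int.
  move=> i; have /ApP[m [k ->]] := PA i; exists k.
  by rewrite mulrCA divff ?mulr1.
pose N := (\sum_(i < size P) k i)%N; exists N.
have NP i : p%:R ^+ N * P`_i \is a Num.int.
  have [iP|iP] := ltnP i (size P); last by rewrite nth_default // mulr0.
  rewrite /N (bigD1 (Ordinal iP)) //= exprD mulrAC rpredM ?kP //.
  by rewrite rpredX // natr_int.
exists (\poly_(i < size P) Num.floor (p%:R ^+ N * P`_i)).
apply/polyP => i; rewrite coefZ coef_map coef_poly /=.
have [iP|iP] := ltnP i (size P); first by rewrite floorK.
by rewrite nth_default // mulr0.
Qed.

(* Gauss's lemma for Z[1/p]. *)
Lemma monic_dvdp_polyOver_Ap (p : nat) (f P : {poly rat}) : prime p ->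
  f \is monic -> P \is monic -> P \is a polyOver (Ap p) -> f %| P ->
  f \is a polyOver (Ap p).
Proof.
move=> p_pr fm Pm /(polyOver_Ap_scale p_pr)[N [Q QE]] fP.
have q0 : p%:R ^+ N != 0 :> rat by rewrite expf_neq0 // pnatr_eq0 -lt0n prime_gt0.
have : f %| map_poly intr Q by rewrite -QE dvdpZr.
move=> /dvdpP_rat_int[f1 [a a0 fE] [r rE]].
have lcQ : (lead_coef Q)%:~R = p%:R ^+ N :> rat.
  rewrite -(lead_coef_map_inj (@intr_inj rat)) -?QE ?lead_coefZ ?(monicP Pm) ?mulr1 //.
have lcf : a * (lead_coef f1)%:~R = 1.
  by move/monicP: fm; rewrite fE lead_coefZ lead_coef_map_inj //; apply: intr_inj.
(* Leading coefficients in f = a f1 and Q = f1 r leave only a power of p in the denominator of a. *)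
have aE : a = (lead_coef r)%:~R / p%:R ^+ N.
  rewrite -lcQ rE lead_coefM intrM; move: lcQ; rewrite rE lead_coefM intrM => lcQ.
  have r0 : (lead_coef r)%:~R != 0 :> rat.
    by apply: contra_neq q0; rewrite -lcQ => ->; rewrite mulr0.
  have f10 : (lead_coef f1)%:~R != 0 :> rat.
    by apply: contra_neq q0; rewrite -lcQ => ->; rewrite mul0r.
  by apply: (mulIf f10); rewrite lcf; field; rewrite r0.
apply/polyOverP => i; rewrite fE coefZ coef_map /= aE.
by apply/ApP; exists (lead_coef r * f1`_i), N; rewrite intrM mulrAC.
Qed.

(** One factor vanishes at b, so f divides it and the other is a constant. As f is monic, the
    inverse of that constant is the leading coefficient of the first factor, which lies in A_p. *)
Lemma annihilator_Ap_irreducible (p : nat) (F : fieldType) (phi : {rmorphism rat -> F})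
  (b : F) (f : {poly rat}) : generates_annihilator phi b f -> Ap_irreducible p f.
Proof.
move=> fP; have [fm fb fmin] := fP; have f0 := monic_neq0 fm.
have unit_const g h : g \is a polyOver (Ap p) -> h \is a polyOver (Ap p) ->
    f = g * h -> size h = 1%N -> Ap_poly_unit p h.
  move=> gA hA fE sh; have [c c0 hE] : exists2 c, c != 0 & h = c%:P.
    by apply/size_poly1P; rewrite sh.
  exists (lead_coef g)%:P; first by rewrite polyOverC; apply/(polyOverP gA).
  rewrite hE -polyCM mulrC; move/monicP: fm.
  by rewrite fE lead_coefM hE lead_coefC => ->.
split=> // [[g _ fg1]|g h gA hA fE].
  have := annihilator_size_gt1 fP.
  have : f %| 1 by apply/dvdpP; exists g; rewrite mulrC fg1.
  by move=> /dvdp_leq; rewrite oner_neq0 size_poly1 => /(_ isT) + h; rewrite leqNgt h.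
have g0 : g != 0 by apply: contra_neq f0; rewrite fE => ->; rewrite mul0r.
have h0 : h != 0 by apply: contra_neq f0; rewrite fE => ->; rewrite mulr0.
have sE : size f = (size g + size h).-1 by rewrite fE size_mul.
have := g0; have := h0; rewrite -!size_poly_gt0 => sh sg.
have := fb; rewrite fE rmorphM rootM.
move=> /orP[/fmin/(dvdp_leq g0) le|/fmin/(dvdp_leq h0) le]; [right|left].
  apply: (@unit_const g h) => //.
  by move: (size f) (size g) (size h) le sE sh sg => *; lia.
apply: (@unit_const h g) => //; first by rewrite mulrC.
by move: (size f) (size g) (size h) le sE sh sg => *; lia.
Qed.

Lemma coef_digit_poly (A : comNzRingType) (d : nat -> A) N i :
  (digit_poly d N)`_i = if (i < N)%N then d (N - i.+1)%N else 0.
Proof.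
rewrite /digit_poly; elim: N i => [|N IH] i; first by rewrite /= coef0.
rewrite /= coefD coefMX coefC; case: i => [|i] /=; first by rewrite add0r subn1.
by rewrite IH addr0 ltnS.
Qed.

Lemma subn_revK i n : (i < n)%N -> (n - (n - i.+1).+1 = i)%N.
Proof. by move=> iN; rewrite subnSK // subKn // ltnW. Qed.

(** * The beta-transformation as a shift radix system *)

Section BetaSRS.
Context (p : nat) (p_pr : prime p) (beta : padic p_pr).
Hypothesis beta_gt1 : 1 < padic_norm beta.
Local Notation Zp := (padic_int p_pr).
Local Notation Qp := (padic p_pr).
Local Notation um := (padic_norm_ultrametric p_pr).
Context (f : {poly rat}).
Hypotheses (fA : f \is a polyOver (Ap p)) (fm : f \is monic).
Hypothesis f_beta : root (map_poly ratr f) beta.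
Local Notation n := (size f).-1.
Local Notation a := (minpoly_coef f).

Let beta0 : beta != 0. Proof. by rewrite -(um_gt0 um) (lt_trans ltr01). Qed.

Let p_gt0 : 0 < p%:R :> rat. Proof. by rewrite ltr0n prime_gt0. Qed.
Let p_gt1 : 1 < p%:R :> rat. Proof. by rewrite ltr1n prime_gt1. Qed.

Lemma monic_root_size : size f = n.+1.
Proof. by rewrite prednK // size_poly_gt0 monic_neq0. Qed.

Lemma monic_root_size_gt1 : (0 < n)%N.
Proof.
rewrite -ltnS -monic_root_size -(size_map_poly (rat_padic p_pr)).
rewrite -ratr_padicE; apply: (root_size_gt1 _ f_beta).
by rewrite ratr_padicE map_poly_eq0 monic_neq0.
Qed.
Let n_gt0 := monic_root_size_gt1.

Lemma minpoly_coef_Ap i : a i \in Ap p.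
Proof. by rewrite rpredN; apply/(polyOverP fA). Qed.

(* w_i = beta^i - a_1 beta^(i-1) - ... - a_i.                                  *)
Definition quot_poly (i : nat) : {poly rat} := digit_poly (fun k => f`_(n - k)) i.+1.
Definition quot_basis (i : nat) : Qp :=
  digit_sum (fun k => ratr f`_(n - k)) i.+1 beta.
Local Notation w := quot_basis.

Lemma horner_quot_poly i : (map_poly ratr (quot_poly i)).[beta] = w i.
Proof. by rewrite /quot_basis ratr_padicE horner_map_digit_poly. Qed.

Lemma quot_basis0 : w 0 = 1.
Proof.
by rewrite /w /= mul0r add0r subn0 -lead_coefE (monicP fm) ratr_padicE rmorph1.
Qed.

Lemma quot_basisS i : beta * w i = w i.+1 + ratr (a i.+1).
Proof.
rewrite mulrC [w i.+1]/(w i * beta + _) /minpoly_coef ratr_padicE.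
by rewrite rmorphN /= addrK.
Qed.

Lemma quot_basis_size : w n = 0.
Proof.
rewrite -horner_quot_poly; suff -> : quot_poly n = f by apply/rootP.
apply/polyP => i; rewrite coef_digit_poly -monic_root_size.
case: ltnP => [|/leq_sizeP->//]; rewrite monic_root_size ltnS subSS => /subKn -> //.
Qed.

Definition quot_comb (N : nat) (y : nat -> rat) : Qp :=
  \sum_(i < N) ratr (y i) * w i.
Local Notation V := quot_comb.

Definition seq_cons (y : nat -> rat) (c : rat) : nat -> rat :=
  fun i => if i is j.+1 then y j else c.

Lemma eq_quot_comb N (y y' : nat -> rat) :
  (forall i, (i < N)%N -> y i = y' i) -> V N y = V N y'.
Proof. by move=> yy; apply: eq_bigr => i _; rewrite yy. Qed.

Lemma quot_comb_cons N y c :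
  V N.+1 (seq_cons y c) = ratr c + \sum_(i < N) ratr (y i) * w i.+1.
Proof. by rewrite /V big_ord_recl quot_basis0 mulr1. Qed.

(** By beta w_i = w_(i+1) + a_(i+1) the coordinates shift up, the a_(i+1) collect at w_0 = 1, and
    the overflow falls on w_n = 0. *)
Lemma quot_comb_step y c :
  V n (seq_cons y (\sum_(i < n) y i * a i.+1 + c)) = beta * V n y + ratr c.
Proof.
have := quot_basis_size; have := n_gt0; case: n => // N _ wN.
rewrite quot_comb_cons mulr_sumr.
under [in RHS]eq_bigr => i _ do rewrite mulrCA quot_basisS mulrDr.
rewrite big_split /= [X in _ = X + _ + _]big_ord_recr /= wN mulr0 addr0.
rewrite ratr_padicE rmorphD rmorph_sum /=.
rewrite [LHS]addrC addrA; congr (_ + _ + _).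
by apply: eq_bigr => i _; rewrite rmorphM.
Qed.

Lemma beta_map_quot_comb (x : Zp) y : x%:F = V n y ->
  (beta_map beta x)%:F = V n (seq_cons y (\sum_(i < n) y i * a i.+1
                                          - padic_frac (beta * x%:F))).
Proof.
move=> xE; rewrite quot_comb_step -xE ratr_padicE rmorphN /=.
by apply/esym/eqP; rewrite subr_eq /beta_map -padic_floor_frac.
Qed.

Lemma horner_quot_comb (g : {poly rat}) : g \is a polyOver (Ap p) ->
  exists2 y, forall i, y i \in Ap p & (map_poly ratr g).[beta] = V n y.
Proof.
elim/poly_ind: g => [|g c IH] gA.
  exists (fun=> 0); first by move=> i; apply: rpred0.
  rewrite ratr_padicE rmorph0 horner0 /V big1 // => i _.
  by rewrite ratr_padicE rmorph0 mul0r.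
have cA : c \in Ap p.
  by have /polyOverP/(_ 0%N) := gA; rewrite coefD coefMX coefC add0r.
have [|y yA gE] := IH.
  apply/polyOverP => i; have /polyOverP/(_ i.+1) := gA.
  by rewrite coefD coefMX coefC addr0.
exists (seq_cons y (\sum_(i < n) y i * a i.+1 + c)).
  case=> [|i] /=; last exact: yA.
  by rewrite rpredD // rpred_sum // => i _; rewrite rpredM ?yA ?minpoly_coef_Ap.
rewrite quot_comb_step -gE ratr_padicE.
by rewrite rmorphD rmorphM /= map_polyX map_polyC hornerMXaddC mulrC.
Qed.

Lemma quot_basis_Ap_adjoin_inv i : (i <= n)%N -> Ap_adjoin_inv beta (w i).
Proof.
move=> /subKn <-; elim: (n - i)%N => [|k IH].
  by rewrite subn0 quot_basis_size; apply: Ap_adjoin_inv0.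
have [kn|nk] := ltnP k n; last first.
  by move: IH; rewrite subnS (eqP nk).
have -> : w (n - k.+1) = beta^-1 * (w (n - k) + ratr (a (n - k))).
  by rewrite -(subnSK kn) -quot_basisS mulKf.
apply: Ap_adjoin_invM; first exact: Ap_adjoin_inv_inv.
apply: Ap_adjoin_invD => //; apply: Ap_adjoin_inv_ratr; exact: minpoly_coef_Ap.
Qed.

Lemma quot_comb_Ap_adjoin_inv y : (forall i, y i \in Ap p) ->
  Ap_adjoin_inv beta (V n y).
Proof.
move=> yA; rewrite /V; elim/big_ind: _ => [|x x'|i _].
- exact: Ap_adjoin_inv0.
- exact: Ap_adjoin_invD.
- apply: Ap_adjoin_invM; last by apply: quot_basis_Ap_adjoin_inv; apply: ltnW.
  exact: Ap_adjoin_inv_ratr.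
Qed.

(** A combination of the [quot_poly i] vanishing at beta is a multiple of f of degree below n, hence
    0. Each [quot_poly i] is monic of degree i, so coefficients are peeled off from the top. *)
Lemma quot_comb_free y : generates_annihilator (rat_padic p_pr) beta f ->
  V n y = 0 -> forall i, (i < n)%N -> y i = 0.
Proof.
move=> [_ _ fmin] Vy.
have P0 : \sum_(i < n) y i *: quot_poly i = 0.
  apply/eqP/negPn/negP => P0.
  have : f %| \sum_(i < n) y i *: quot_poly i.
    apply: fmin; apply/rootP; rewrite -[RHS]Vy rmorph_sum horner_sum.
    by apply: eq_bigr => i _; rewrite /= map_polyZ hornerZ horner_quot_poly.
  move/dvdp_leq => /(_ P0); rewrite leqNgt monic_root_size ltnS => /negP; apply.
  apply: (leq_trans (size_sum _ _ _)); apply/bigmax_leqP => i _.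
  apply: leq_trans (size_scale_leq _ _) _.
  exact: leq_trans (size_digit_poly _ _) (ltn_ord i).
suff : forall N, \sum_(i < N) y i *: quot_poly i = 0 ->
    forall i, (i < N)%N -> y i = 0 by apply.
elim=> // N IH; rewrite big_ord_recr /= => PN.
have yN : y N = 0.
  move/(congr1 (fun q : {poly rat} => q`_N)): PN.
  rewrite coefD coef_sum coef0 coefZ coef_digit_poly ltnS leqnn subnn subn0.
  rewrite -lead_coefE (monicP fm) mulr1 big1 ?add0r // => i _.
  by rewrite coefZ coef_digit_poly ltnS leqNgt ltn_ord mulr0.
move: PN; rewrite yN scale0r addr0 => /IH {}IH i.
by rewrite ltnS leq_eqVlt => /orP[/eqP->|/IH].
Qed.

Hypothesis dom : forall i, (2 <= i <= n)%N ->
  padic_norm (ratr (a i) : Qp) < padic_norm beta.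

(** Descending induction from w_n = 0, using beta w_i = w_(i+1) + a_(i+1). *)
Lemma quot_basis_lt1 i : (0 < i <= n)%N -> padic_norm (w i) < 1.
Proof.
move=> /andP[+ /subKn iE]; rewrite -iE; elim: (n - i)%N => [_|k IH].
  by rewrite subn0 quot_basis_size (um0 um).
rewrite subn_gt0 => kn.
have b0 : 0 < padic_norm beta by rewrite (lt_trans ltr01).
rewrite -(ltr_pM2l b0) mulr1 -(umM um) quot_basisS subnSK //; last exact: ltnW.
apply: (umD_lt um); last first.
  by apply: dom; rewrite leq_subr andbT ltn_subRL addn1.
by apply: lt_trans beta_gt1; apply: IH; rewrite subn_gt0 ltnW.
Qed.

Lemma quot_basis_le1 i : (i <= n)%N -> padic_norm (w i) <= 1.
Proof.
case: i => [|i] ilt; first by rewrite quot_basis0 (um1 um).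
by rewrite ltW // quot_basis_lt1.
Qed.

Lemma quot_comb_cons_norm y c (B : rat) : 0 <= B ->
  padic_norm (V n (seq_cons y c)) <= B ->
  (forall i, (i.+1 < n)%N -> padic_norm (ratr (y i) * w i.+1) <= B) ->
  padic_norm (ratr c : Qp) <= B.
Proof.
have := n_gt0; case: n => // N _ B0; rewrite quot_comb_cons => VB yB.
rewrite -[ratr c](addrK (\sum_(i < N) ratr (y i) * w i.+1)).
by apply: (umB_le um) => //; apply: (um_sum_le um) => // i _; apply: yB; rewrite ltnS.
Qed.

(** The new coordinate s - d lies in A_p, and in Z_p because all other terms do; being an integer
    with 0 <= d < 1, it is the floor of s. *)
Lemma quot_comb_int (x : Zp) y : x%:F = V n y ->
  (forall i, (i < n)%N -> y i \is a Num.int) ->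
  (beta_map beta x)%:F =
  V n (seq_cons y (Num.floor (\sum_(i < n) y i * a i.+1))%:~R).
Proof.
move=> xE yint; rewrite (beta_map_quot_comb xE).
set s := \sum_(i < n) _; set d := padic_frac _.
have /intrP[m cE] : s - d \is a Num.int.
  have sA : s \in Ap p.
    apply: rpred_sum => i _; rewrite rpredM ?minpoly_coef_Ap //.
    by have /intrP[k ->] := yint i (ltn_ord i); rewrite rpred_int.
  apply: (@Ap_padic_integer _ p_pr); first by rewrite rpredB ?padic_frac_Ap.
  apply: (quot_comb_cons_norm (y := y) ler01).
    by rewrite -(beta_map_quot_comb xE) padic_norm_tofrac_le1.
  move=> i iN; rewrite (umM um); apply: mulr_ile1; try exact: (um_ge0 um).
    have /intrP[k ->] := yint i (ltnW iN).
    by rewrite ratr_int; apply: padic_norm_int_le1.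
  by apply: quot_basis_le1; apply: ltnW.
rewrite cE; congr (V _ (seq_cons _ _%:~R)).
apply/esym/floor_def; rewrite intrD -cE.
by have := padic_frac_ge0 (beta * x%:F); have := padic_frac_lt1 (beta * x%:F);
  rewrite -/d => *; apply/andP; split; lra.
Qed.

Let p_exp_gt0 k : 0 < p%:R ^+ k :> rat. Proof. by rewrite exprn_gt0. Qed.

(** After n steps every coordinate is new, and a new one is bounded by the larger of 1 and p^e / p;
    the truncated [e.-1] covers e = 0. *)
Lemma quot_comb_contract e (x : Zp) y : (forall i, y i \in Ap p) -> x%:F = V n y ->
  (forall i, (i < n)%N -> padic_norm (ratr (y i) : Qp) <= p%:R ^+ e) ->
  exists k y', [/\ forall i, y' i \in Ap p, beta_orbit beta x k = V n y' &
    forall i, (i < n)%N -> padic_norm (ratr (y' i) : Qp) <= p%:R ^+ e.-1].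
Proof.
move=> yA xE ye.
suff main k : exists y', [/\ forall i, y' i \in Ap p,
    beta_orbit beta x k = V n y',
    forall i, (i < n)%N -> padic_norm (ratr (y' i) : Qp) <= p%:R ^+ e &
    forall i, (i < n)%N -> (i < k)%N ->
      padic_norm (ratr (y' i) : Qp) <= p%:R ^+ e.-1].
  by have [y' [y'A xE' _ y'e]] := main n; exists n, y'; split=> // i iN; apply: y'e.
elim: k => [|k [y' [y'A xE' y'e y'k]]]; first by exists y.
set c := \sum_(i < n) y' i * a i.+1 - padic_frac (beta * beta_orbit beta x k).
have ple : p%:R ^+ e.-1 <= p%:R ^+ e :> rat by rewrite ler_weXn2l ?leq_pred // ltW.
have cE : padic_norm (ratr c : Qp) <= p%:R ^+ e.-1.
  apply: (quot_comb_cons_norm (y := y') (ltW (p_exp_gt0 _))).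
    rewrite -(beta_map_quot_comb xE') (le_trans (padic_norm_tofrac_le1 _)) //.
    by rewrite exprn_ege1 // ltW.
  move=> i iN; rewrite (umM um).
  have wp : padic_norm (w i.+1) <= p%:R^-1.
    by apply: padic_norm_lt1; apply: quot_basis_lt1; rewrite /= ltnW.
  have := ler_pM (um_ge0 um _) (um_ge0 um _) (y'e i (ltnW iN)) wp.
  move/le_trans; apply; case: e {ye y'e y'k ple c} => [|e] /=.
    by rewrite expr0 mul1r invf_le1 // ltW.
  by rewrite exprSr mulfK // gt_eqF.
exists (seq_cons y' c); split.
- case=> [|i] //=; rewrite rpredB ?padic_frac_Ap // rpred_sum // => i _.
  by rewrite rpredM ?y'A ?minpoly_coef_Ap.
- exact: beta_map_quot_comb.
- by case=> [|i] iN /=; [apply: le_trans cE ple|apply: y'e; apply: ltnW].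
- by case=> [|i] iN /= ik; [|apply: y'k => //; apply: ltnW].
Qed.

Lemma quot_comb_eventually_int (x : Zp) y : (forall i, y i \in Ap p) -> x%:F = V n y ->
  exists k y', beta_orbit beta x k = V n y' /\
    forall i, (i < n)%N -> y' i \is a Num.int.
Proof.
move=> yA xE.
suff main e : forall (x : Zp) y, (forall i, y i \in Ap p) -> x%:F = V n y ->
    (forall i, (i < n)%N -> padic_norm (ratr (y i) : Qp) <= p%:R ^+ e) ->
    exists k y', beta_orbit beta x k = V n y' /\
      forall i, (i < n)%N -> y' i \is a Num.int.
  apply: (main (\sum_(i < n) Num.bound (padic_norm (ratr (y i) : Qp)))%N x y yA xE).
  move=> i iN; apply: ltW; apply: lt_le_trans (archi_boundP (um_ge0 um _)) _.
  rewrite -natrX ler_nat ltnW //; apply: leq_ltn_trans (ltn_expl _ (prime_gt1 p_pr)).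
  by rewrite (bigD1 (Ordinal iN)) //= leq_addr.
elim: e {x y yA xE} => [|e IH] x y yA xE ye.
  exists 0%N, y; split=> // i iN; apply: (@Ap_padic_integer _ p_pr) => //.
  by rewrite -(expr0 p%:R) ye.
have [k [y' [y'A xE' /= y'e]]] := quot_comb_contract yA xE ye.
have [l [y'' [xE'' y''int]]] := IH _ _ y'A xE' y'e.
by exists (l + k)%N, y''; split=> //; rewrite -xE'' /beta_orbit iterD.
Qed.

Context (R : realType).

(* The y_i with z = - (y_(n-1), ..., y_0).  For i >= n the truncated index     *)
(* n - i.+1 is 0; quot_comb n never reads these values.                        *)
Definition srs_coord (z : 'rV[int]_n) (i : nat) : rat :=
  - (if insub (n - i.+1)%N is Some j then z 0 j else 0)%:~R.

Lemma srs_coordE z (j : 'I_n) : srs_coord z (n - j.+1) = - (z 0 j)%:~R.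
Proof.
by rewrite /srs_coord subn_revK // valK.
Qed.

Lemma srs_coord_int z i : srs_coord z i \is a Num.int.
Proof. by rewrite rpredN rpred_int. Qed.

Lemma srs_coord_surj y : (forall i, (i < n)%N -> y i \is a Num.int) ->
  exists z, forall i, (i < n)%N -> srs_coord z i = y i.
Proof.
move=> yint; exists (\row_(j < n) - Num.floor (y (n - j.+1)%N)) => i iN.
have jN : (n - i.+1 < n)%N by rewrite subnSK ?leq_subr.
rewrite -{1}(subn_revK iN) -[(n - i.+1)%N]/(nat_of_ord (Ordinal jN)) srs_coordE mxE.
by rewrite /= subn_revK // intrN opprK floorK // yint.
Qed.

(** The sign and the reversal in [srs_coord] turn the entry - floor (-a . z) into the floor of the
    sum of the y_i a_(i+1). *)
Lemma srs_coord_map z i : (i < n)%N ->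
  srs_coord (srs_map (- minpoly_vec R f) z) i =
  seq_cons (srs_coord z) (Num.floor (\sum_(i < n) srs_coord z i * a i.+1))%:~R i.
Proof.
move=> iN; have jN : (n - i.+1 < n)%N by rewrite subnSK ?leq_subr.
rewrite -{1}(subn_revK iN) -[(n - i.+1)%N]/(nat_of_ord (Ordinal jN)) srs_coordE mxE.
rewrite /= subnSK //; case: i iN {jN} => [|i] iN; last first.
  have iN' : (n - i.+1 < n)%N by rewrite subnSK ?leq_subr // ltnW.
  have := srs_coordE z (Ordinal iN'); rewrite /= subn_revK 1?ltnW // => ->.
  by rewrite insubT.
rewrite subn0 insubF ?ltnn //=.
rewrite intrN opprK; congr (_%:~R).
rewrite -(floor_rat R) rmorph_sum /=; congr Num.floor.
rewrite [RHS](reindex_inj rev_ord_inj) /=.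
apply: eq_bigr => j _; rewrite !mxE rmorphM /= srs_coordE subnSK // (rmorphN _ (z 0 j)%:~R) /=.
by rewrite ratr_int mulNr mulrC mulNr.
Qed.

Lemma beta_map_srs (x : Zp) z k : x%:F = V n (srs_coord z) ->
  beta_orbit beta x k = V n (srs_coord (iter k (srs_map (- minpoly_vec R f)) z)).
Proof.
move=> xE; elim: k => [//|k IH]; rewrite iterS.
rewrite /beta_orbit iterS (quot_comb_int IH (fun i _ => srs_coord_int _ i)).
by apply: eq_quot_comb => i iN; rewrite srs_coord_map.
Qed.

Lemma srs_coord_eq0 z : (forall i, (i < n)%N -> srs_coord z i = 0) <-> z = 0.
Proof.
split=> [z0|-> i _]; last first.
  by rewrite /srs_coord; case: insub => [j|]; rewrite ?mxE oppr0.
apply/rowP => j; rewrite mxE; have := z0 (n - j.+1)%N; rewrite srs_coordE.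
move=> /(_ _)/eqP; rewrite oppr_eq0 intr_eq0 => /(_ _)/eqP; apply.
by rewrite subnSK ?leq_subr.
Qed.

Lemma Ap_adjoin_inv_denominator (x : Qp) : Ap_adjoin_inv beta x ->
  exists k (g : {poly rat}), g \is a polyOver (Ap p) /\
    beta ^+ k * x = (map_poly ratr g).[beta].
Proof.
move/Ap_adjoin_invP => /(_ [set x | exists k (g : {poly rat}),
  g \is a polyOver (Ap p) /\ beta ^+ k * x = (map_poly ratr g).[beta]]); apply.
- have X0 k g : (map_poly ratr ('X^k * g)).[beta] = beta ^+ k * (map_poly ratr g).[beta].
    rewrite ratr_padicE rmorphM /= map_polyXn hornerM.
    by rewrite hornerXn.
  split=> [|x1 x2|x1 x2]; rewrite !inE.
  + exists 0%N, 1; split; first exact: rpred1.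
    by rewrite ratr_padicE rmorph1 hornerC mulr1.
  + move=> [k1 [g1 [g1A E1]]] [k2 [g2 [g2A E2]]].
    exists (k1 + k2)%N, ('X^k2 * g1 - 'X^k1 * g2); split.
      by rewrite rpredB ?rpredM ?rpredX ?polyOverX.
    have -> : map_poly ratr ('X^k2 * g1 - 'X^k1 * g2) =
        map_poly ratr ('X^k2 * g1) - map_poly ratr ('X^k1 * g2) :> {poly Qp}.
      by rewrite ratr_padicE rmorphB.
    by rewrite hornerD hornerN !X0 -E1 -E2 exprD mulrBr !mulrA [beta ^+ k2 * _]mulrC.
  + move=> [k1 [g1 [g1A E1]]] [k2 [g2 [g2A E2]]].
    exists (k1 + k2)%N, (g1 * g2); split; first by rewrite rpredM.
    have -> : map_poly ratr (g1 * g2) =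
        map_poly ratr g1 * map_poly ratr g2 :> {poly Qp}.
      by rewrite ratr_padicE rmorphM.
    by rewrite hornerM -E1 -E2 exprD mulrACA.
- move=> c cA; exists 0%N, c%:P; split; first by rewrite polyOverC.
  by rewrite ratr_padicE map_polyC hornerC mul1r.
- exists 1%N, 1; split; first exact: rpred1.
  by rewrite ratr_padicE rmorph1 hornerC expr1 divff.
Qed.

(** T^k x is beta^k x minus a polynomial in beta formed from the digits, and a suitable k clears the
    powers of 1/beta in x. *)
Lemma beta_orbit_horner (x : Zp) : Ap_adjoin_inv beta x%:F ->
  exists k (g : {poly rat}), g \is a polyOver (Ap p) /\
    beta_orbit beta x k = (map_poly ratr g).[beta].
Proof.
move=> /Ap_adjoin_inv_denominator[k [g [gA gE]]].
pose dg := beta_digit beta x.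
exists k, (g - digit_poly dg k); split.
  rewrite rpredB //.
  by apply: digit_poly_over => i; apply: beta_digit_Ap.
have := digit_sum_div beta k (beta_orbitS beta x).
rewrite subrr mul0r => /esym/eqP; rewrite subr_eq add0r => /eqP <-.
rewrite mulrC gE ratr_padicE rmorphB hornerD hornerN.
by rewrite horner_map_digit_poly.
Qed.

Lemma srs_D0_Fin : - minpoly_vec R f \in srs_D0 R n ->
  Fin beta = Ap_adjoin_inv beta `&` padic_integers p_pr.
Proof.
rewrite inE => D0; apply/seteqP; split; first exact: Fin_sub_Ap_adjoin_inv.
move=> x' [xA [x _ xE]]; rewrite -{x'}xE in xA *.
have [k [g [gA gE]]] := beta_orbit_horner xA.
have [y yA yE] := horner_quot_comb gA; rewrite yE in gE.
have [l [y' [yE' y'int]]] := quot_comb_eventually_int yA gE.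
have [z zE] := srs_coord_surj y'int.
rewrite -(eq_quot_comb zE) in yE'.
have [m _ zm] := D0 z; have := beta_map_srs m yE'.
rewrite zm => xm; apply/(FinP beta_gt1); exists x => //; exists (m + (l + k))%N.
apply/eqP; rewrite -tofrac_eq0; apply/eqP.
move: xm; rewrite /beta_orbit !iterD => ->; rewrite /V big1 // => i _.
by rewrite (srs_coord_eq0 0).2 // ratr_padicE rmorph0 mul0r.
Qed.

Lemma Fin_srs_D0 : generates_annihilator (rat_padic p_pr) beta f ->
  Fin beta = Ap_adjoin_inv beta `&` padic_integers p_pr ->
  - minpoly_vec R f \in srs_D0 R n.
Proof.
move=> fmin FinE; rewrite inE => z.
have /padic_norm_le1[x xE] : padic_norm (V n (srs_coord z)) <= 1.
  apply: (um_sum_le um) => // i _; rewrite (umM um).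
  apply: mulr_ile1; try exact: (um_ge0 um).
    have /intrP[m ->] := srs_coord_int z i.
    by rewrite ratr_int; apply: padic_norm_int_le1.
  by apply: quot_basis_le1; apply: ltnW.
have : Fin beta x%:F.
  rewrite FinE; split; last by exists x.
  rewrite -xE; apply: quot_comb_Ap_adjoin_inv => i.
  by have /intrP[m ->] := srs_coord_int z i; rewrite rpred_int.
move=> /(FinP beta_gt1)[x' /eqP]; rewrite tofrac_eq => /eqP <- [M xM].
(* One step beyond M makes the exponent positive; T fixes 0. *)
exists M.+1 => //; have := beta_map_srs M.+1 (esym xE).
rewrite /beta_orbit iterS xM beta_map0 tofrac0 => /esym/(quot_comb_free fmin).
by move/srs_coord_eq0.
Qed.

End BetaSRS.

(** * Complex conjugates on the unit circle *)

Section UnitCircle.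
Context (C : numClosedFieldType) (F : fieldType) (phi : {rmorphism rat -> F}) (b : F).
Context (f : {poly rat}) (fP : generates_annihilator phi b f).

(* A root on the unit circle is shared with the reciprocal polynomial, so f  *)
(* is self-reciprocal up to a sign.                                          *)
Lemma annihilator_unit_circle (z : C) :
  root (map_poly ratr f) z -> `|z| = 1 -> f`_0 = 1 \/ f`_0 = -1.
Proof.
move=> fz z1; have [fm _ _] := fP.
set n := (size f).-1; have sf : size f = n.+1.
  by rewrite prednK // size_poly_gt0 monic_neq0.
have fn : f`_n = 1 by rewrite -lead_coefE (monicP fm).
pose g := \poly_(i < n.+1) f`_(n - i).
have g0 : g`_0 = 1 by rewrite coef_poly subn0.
have gn : g`_n = f`_0 by rewrite coef_poly ltnS leqnn subnn.
have zz : z^* * z = 1 by rewrite -normCKC z1 expr1n.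
(* The complex conjugate of z is 1 / z, so conj (g(z)) z^n = f(z). *)
have gz : (map_poly ratr g).[z] = 0.
  apply: (fmorph_inj (@Num.conj C)); rewrite rmorph0.
  have z0 : z ^+ n != 0.
    by rewrite expf_neq0 // -normr_gt0 z1.
  apply: (mulIf z0); rewrite mul0r -(rootP fz).
  rewrite (@horner_coef_wide _ n.+1); last first.
    by rewrite size_map_poly; apply: size_poly.
  rewrite (@horner_coef_wide _ n.+1 (map_poly _ f)) ?size_map_poly ?sf //.
  rewrite rmorph_sum mulr_suml [RHS](reindex_inj rev_ord_inj) /=.
  apply: eq_bigr => i _; rewrite !coef_map coef_poly ltn_ord rmorphM rmorphXn /=.
  rewrite fmorph_rat subSS -mulrA; congr (_ * _).
  have -> : z ^+ n = z ^+ (n - i) * z ^+ i by rewrite -exprD subnK // -ltnS.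
  by rewrite mulrCA -exprMn zz expr1n mulr1.
have [fg|cop] := annihilator_coprime fP g; last first.
  have := coprimep_root (_ : coprimep (map_poly ratr f) (map_poly ratr g)) fz.
  by rewrite gz eqxx coprimep_map => /(_ cop).
have gN0 : g != 0.
  by apply/eqP => gE; move: g0; rewrite gE coef0 => /esym/eqP; rewrite oner_eq0.
have /dvdpP[q qE] := fg.
have qN0 : q != 0 by apply: contra_neq gN0 => q0; rewrite qE q0 mul0r.
have sq : size q = 1%N.
  have : (size g <= n.+1)%N by apply: size_poly.
  rewrite qE size_mul ?(monic_neq0 fm) // sf addnS /=.
  by move: qN0; rewrite -size_poly_gt0; move: (size q) => k; lia.
have [c c0 qc] : exists2 c, c != 0 & q = c%:P by apply/size_poly1P; rewrite sq.
have gE i : g`_i = c * f`_i by rewrite qE qc coefCM.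
(* Coefficients 0 and n of g = c f give c f_0 = 1 and f_0 = c. *)
have cf0 : c * f`_0 = 1 by rewrite -gE.
have : f`_0 = c by rewrite -gn gE fn mulr1.
move=> f0c; have : f`_0 ^+ 2 == 1 by rewrite expr2 {1}f0c cf0.
by rewrite sqrf_eq1 => /orP[/eqP|/eqP]; [left|right].
Qed.

End UnitCircle.

(* The coordinate dropped by the shift is z_1; when r_1 = 1 or -1 it is still *)
(* seen by the floor, so only 0 is mapped to 0.                               *)
Lemma srs_D0_neq1 (R : realType) (n : nat) (r : 'rV[R]_n) (j0 : 'I_n) :
  r \in srs_D0 R n -> j0 = 0%N :> nat -> `|r 0 j0| != 1.
Proof.
rewrite inE => D0 j00; apply/eqP => r1.
have inj z : srs_map r z = 0 -> z = 0.
  move=> tz; have zS (j : 'I_n) : j != j0 -> z 0 j = 0.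
    move=> jj0; have j_gt0 : (0 < j)%N by rewrite lt0n -j00; apply: contra jj0 => /eqP/ord_inj->.
    have jN : (j.-1 < n)%N by rewrite (leq_ltn_trans (leq_pred _)).
    move/rowP/(_ (Ordinal jN)): tz; rewrite !mxE /=.
    by rewrite prednK // valK.
  have n0 : (0 < n)%N by rewrite (leq_ltn_trans _ (ltn_ord j0)).
  have jN : (n.-1 < n)%N by rewrite prednK.
  move/rowP/(_ (Ordinal jN)): tz; rewrite !mxE /= insubF ?prednK ?ltnn //.
  rewrite (bigD1 j0) //= big1 ?addr0 => [|j jj0]; last by rewrite zS // mulr0.
  move=> fl0; apply/rowP => j; rewrite mxE.
  have [->|/zS//] := eqVneq j j0.
  have : (r 0 j0 == 1) || (r 0 j0 == -1).
    by have := eqr_norml (r 0 j0) 1; rewrite r1 eqxx ler01 andbT => <-.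
  case/orP => /eqP rE; move/eqP: fl0; rewrite rE oppr_eq0.
    by rewrite mul1r intrKfloor => /eqP.
  by rewrite mulN1r -intrN intrKfloor oppr_eq0 => /eqP.
pose z : 'rV[int]_n := const_mx 1.
have [k _ zk] := D0 z.
have : z = 0 by elim: k zk => // k IH; rewrite iterS => /inj/IH.
by move/rowP/(_ j0); rewrite !mxE.
Qed.

(** * Consequences of the finiteness property for the conjugates *)

Section FinProperty.
Context (p : nat) (p_pr : prime p) (beta : padic p_pr).
Hypothesis beta_gt1 : 1 < padic_norm beta.
Local Notation Zp := (padic_int p_pr).
Local Notation Qp := (padic p_pr).
Local Notation um := (padic_norm_ultrametric p_pr).
Hypothesis FinE : Fin beta = Ap_adjoin_inv beta `&` padic_integers p_pr.

Let beta0 : beta != 0. Proof. by rewrite -(um_gt0 um) (lt_trans ltr01). Qed.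

Lemma Fin_expansion (c : rat) (j : nat) : c \in Ap p ->
  padic_norm (ratr c / beta ^+ j) <= 1 ->
  exists M (a : Zp), a%:F = ratr c / beta ^+ j /\ beta_orbit beta a M = 0.
Proof.
move=> cA /padic_norm_le1[a aE].
have : Fin beta a%:F.
  rewrite FinE -aE; split; last by exists a.
  rewrite -exprVn; apply: Ap_adjoin_invM; first exact: Ap_adjoin_inv_ratr.
  by apply: Ap_adjoin_invX; apply: Ap_adjoin_inv_inv.
move=> /(FinP beta_gt1)[a' /eqP]; rewrite tofrac_eq => /eqP <- [M aM].
by exists M, a; split; rewrite // /beta_orbit aM tofrac0.
Qed.

(** The relation holds at beta, so f divides the corresponding polynomial. The real digit bound
    serves complex roots, the p-adic one roots in K. *)
Lemma Fin_relation (f : {poly rat}) (c : rat) (j : nat) :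
  generates_annihilator (rat_padic p_pr) beta f ->
  c \in Ap p -> padic_norm (ratr c / beta ^+ j) <= 1 ->
  exists M (d : nat -> rat),
    [/\ forall k, 0 <= d k < 1,
        forall k, padic_norm (ratr (d k) : Qp) <= padic_norm beta &
        forall (F : fieldType) (phi : {rmorphism rat -> F}) (x : F),
          root (map_poly phi f) x ->
          phi c * x ^+ M = x ^+ j * digit_sum (phi \o d) M x].
Proof.
move=> [_ _ fmin] cA cj; have [M [a [aE aM]]] := Fin_expansion cA cj.
exists M, (beta_digit beta a); split.
- by move=> k; rewrite padic_frac_ge0 padic_frac_lt1.
- exact: beta_digit_norm.
have eval (F : fieldType) (phi : {rmorphism rat -> F}) (x : F) :
    (map_poly phi (c *: 'X^M - 'X^j * digit_poly (beta_digit beta a) M)).[x] =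
    phi c * x ^+ M - x ^+ j * digit_sum (phi \o beta_digit beta a) M x.
  rewrite rmorphB rmorphM /= map_polyZ /= !map_polyXn hornerD hornerN hornerM.
  by rewrite hornerZ !hornerXn horner_map_digit_poly.
move=> F phi x fx; apply/eqP; rewrite -subr_eq0 -eval -/(root _ x).
have /dvdpP[q ->] : f %| c *: 'X^M - 'X^j * digit_poly (beta_digit beta a) M.
  apply: fmin; rewrite /root eval subr_eq0.
  have := digit_sum_div beta M (beta_orbitS beta a).
  rewrite subrr mul0r aM subr0 => /esym/eqP; rewrite subr_eq0.
  rewrite /= /beta_orbit /= aE ratr_padicE => /eqP <-.
  by rewrite mulrA [_ * (_ / _)]mulrC mulfVK ?expf_neq0.
by rewrite rmorphM rootM fx orbT.
Qed.

Lemma Fin_one_poly : exists M (a : Zp),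
  [/\ a = 1, beta_orbit beta a M.+1 = 0 &
      root (map_poly ratr ('X^(M.+1) - digit_poly (beta_digit beta a) M.+1)) beta].
Proof.
have [|M [a [aE aM]]] := @Fin_expansion 1 0 (rpred1 (Ap p)).
  by rewrite expr0 divr1 ratr_padicE rmorph1 (um1 um).
have a1 : a = 1.
  apply/eqP; rewrite -tofrac_eq aE ratr_padicE rmorph1 expr0 divr1 tofrac1.
  by [].
case: M aM => [|M] aM.
  by move: aM; rewrite /beta_orbit /= a1 tofrac1 => /eqP; rewrite oner_eq0.
exists M, a; split=> //.
have := digit_sum_div beta M.+1 (beta_orbitS beta a).
rewrite subrr mul0r aM subr0 => /esym/eqP; rewrite subr_eq0.
rewrite {1}/beta_orbit /= a1 tofrac1 mul1r => /eqP e.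
rewrite /root ratr_padicE rmorphB /= map_polyXn hornerD hornerN hornerXn.
by rewrite horner_map_digit_poly e subrr.
Qed.

Lemma Fin_annihilator : exists f : {poly rat},
  generates_annihilator (rat_padic p_pr) beta f /\ f \is a polyOver (Ap p).
Proof.
have [M [a [a1 _ Pb]]] := Fin_one_poly.
set P := 'X^(M.+1) - _ in Pb.
have Pm : P \is monic.
  rewrite monicE /P lead_coefDl ?lead_coefXn //.
  by rewrite size_polyN size_polyXn ltnS size_digit_poly.
rewrite ratr_padicE in Pb.
have [f fP] := generates_annihilator_exists (monic_neq0 Pm) Pb.
exists f; split=> //; have [fm _ fmin] := fP.
apply: (monic_dvdp_polyOver_Ap p_pr fm Pm _ (fmin _ Pb)).
rewrite rpredB ?rpredX ?polyOverX //.
by apply: digit_poly_over => k; apply: beta_digit_Ap.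
Qed.

Context (R : realType) (K : closedFieldType) (iota : {rmorphism Qp -> K}).
Context (absK : K -> R) (absK_ext : extends_padic_norm iota absK).

Lemma extends_padic_norm_ultrametric : ultrametric absK.
Proof.
case: absK_ext => a0 aM aD _; split=> // x; first by have [] := a0 x.
by apply/eqP/eqP => /(a0 x).2.
Qed.
Local Notation umK := extends_padic_norm_ultrametric.

Lemma absK_iota x : absK (iota x) = ratr (padic_norm x).
Proof. by case: absK_ext. Qed.

Lemma map_ratr_iota (f : {poly rat}) :
  map_poly ratr f = map_poly iota (map_poly (rat_padic p_pr) f).
Proof.
rewrite -map_poly_comp; apply: eq_map_poly => c /=.
by rewrite /rat_padic fmorph_rat.
Qed.

Context (f : {poly rat}) (fP : generates_annihilator (rat_padic p_pr) beta f).
Local Notation n := (size f).-1.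

(* With x_k the orbit of 1, the polynomial of Fin_one_poly is                 *)
(* (X - beta) (X^M + x_1 X^(M-1) + ... + x_M), and the x_k lie in Z_p.        *)
Lemma cofactor_root_le1 (g : {poly Qp}) (x : K) :
  map_poly (rat_padic p_pr) f = ('X - beta%:P) * g ->
  root (map_poly iota g) x -> absK x <= 1.
Proof.
move=> fg gx; have [M [a [a1 aM Pb]]] := Fin_one_poly.
have [_ _ fmin] := fP.
have /dvdpP[h hE] := fmin _ Pb.
have XB0 : 'X - beta%:P != 0 by rewrite polyXsubC_eq0.
have : digit_poly (beta_orbit beta a) M.+1 = g * map_poly (rat_padic p_pr) h.
  apply: (mulfI XB0); rewrite mulrA -fg -rmorphM /= [f * h]mulrC -hE.
  have := @digit_sum_div _ (polyC \o ratr \o beta_digit beta a)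
    (polyC \o beta_orbit beta a) 'X beta%:P M.+1.
  move=> ->; last by move=> k; rewrite /= -polyCM beta_orbitS polyCD.
  rewrite /= aM polyC0 subr0 {1}/beta_orbit /= a1 tofrac1 mul1r.
  by rewrite rmorphB /= map_polyXn map_digit_poly.
move=> /(congr1 (map_poly iota)) /(congr1 (fun q => q.[x])).
rewrite horner_map_digit_poly rmorphM hornerM (rootP gx) mul0r => Q0.
rewrite leNgt; apply/negP => x1.
have : absK (digit_sum (iota \o beta_orbit beta a) M.+1 x) = absK x ^+ M.
  apply: (um_digit_sum_monic umK M x1) => [|k] /=.
    by rewrite /beta_orbit /= a1 tofrac1 rmorph1.
  by rewrite absK_iota -(rmorph1 (@ratr R)) ler_rat beta_orbit_le1.
rewrite Q0 (um0 umK) => /esym/eqP; apply/negP.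
by rewrite expf_neq0 // gt_eqF // (lt_trans ltr01).
Qed.

(** At |x| = 1 the relation for c / beta^2 gives |c| = |digit sum| <= |beta|, so any c with |beta| <
    |c| <= |beta|^2 is contradictory. *)
Lemma root_abs_neq1 (x : K) : root (map_poly ratr f) x -> absK x != 1.
Proof.
move=> fx; apply/eqP => x1; have [k bE] := padic_norm_gt1_exp beta_gt1.
have p0 : p%:R != 0 :> rat by rewrite pnatr_eq0 -lt0n prime_gt0.
have p1 : 1 < p%:R :> rat by rewrite ltr1n prime_gt1.
(* Since |beta| = p^(k+1), this c has |c| = p |beta| and |c / beta^2| = p^(-k). *)
pose c : rat := p%:R ^- k.+2.
have cE : padic_norm (ratr c : Qp) = p%:R ^+ k.+2.
  rewrite /c ratr_padicE fmorphV rmorphXn /= rmorph_nat (umV um) (umX um).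
  by rewrite padic_norm_natp exprVn invrK.
have cA : c \in Ap p by apply/ApP; exists 1, k.+2; rewrite div1r.
have [|M [d [_ dn rel]]] := Fin_relation (j := 2) fP cA.
  rewrite (umM um) cE (umV um) (umX um) bE -exprM ler_pdivrMr ?mul1r.
    by rewrite ler_eXn2l //; lia.
  by rewrite exprn_gt0 // (lt_trans ltr01).
have := rel K (iota \o rat_padic p_pr) x.
rewrite map_poly_comp -map_ratr_iota => /(_ fx)/(congr1 absK).
rewrite !(umM umK) !(umX umK) x1 !expr1n mulr1 absK_iota cE => e.
have : ratr (p%:R ^+ k.+2) <= ratr (p%:R ^+ k.+1) :> R.
  rewrite e !mul1r; apply: (um_digit_sum_le umK); rewrite ?x1 //.
    by rewrite ler0q exprn_ge0.
  by move=> i; rewrite /= absK_iota ler_rat -bE dn.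
by rewrite ler_rat ler_eXn2l // ltnn.
Qed.

Lemma cofactor_root_lt1 (g : {poly Qp}) (x : K) :
  map_poly (rat_padic p_pr) f = ('X - beta%:P) * g ->
  root (map_poly iota g) x -> absK x < 1.
Proof.
move=> fg gx; rewrite lt_neqAle (cofactor_root_le1 fg gx) andbT.
by apply: root_abs_neq1; rewrite map_ratr_iota fg rmorphM rootM gx orbT.
Qed.

Lemma conjugate_abs_le1 (x : K) :
  root (map_poly ratr f) x -> x != iota beta -> absK x <= 1.
Proof.
have [g [fg _ _]] := (annihilator_factor fP).
rewrite map_ratr_iota fg rmorphM rootM => /orP[|gx _]; last exact: cofactor_root_le1 gx.
by rewrite rmorphB /= map_polyX map_polyC root_XsubC => ->.
Qed.

Lemma cofactor_coef_lt1 (g : {poly Qp}) i :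
  map_poly (rat_padic p_pr) f = ('X - beta%:P) * g -> g \is monic ->
  (i < (size g).-1)%N -> padic_norm g`_i < 1.
Proof.
move=> fg gm ig; rewrite -(ltr_rat R) rmorph1 -absK_iota -coef_map.
have [s sE] := closed_field_poly_normal (map_poly iota g).
have gM : map_poly iota g \is monic by rewrite map_monic.
have ss : size s = (size g).-1.
  have := size_prod_XsubC s id; rewrite -(size_map_poly iota) sE (monicP gM) scale1r.
  by move=> ->.
rewrite sE (monicP gM) scale1r; apply: (um_prod_XsubC_coef umK); rewrite ?ss //.
apply/allP => x xs; apply: (cofactor_root_lt1 fg).
by rewrite sE (monicP gM) scale1r root_prod_XsubC.
Qed.

(** In f = (X - beta) g, the coefficient of X^(n-i) involves only non-leading coefficients of g when
    i >= 2, and these are small. *)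
Lemma annihilator_dominant i : (2 <= i <= n)%N ->
  padic_norm (ratr (minpoly_coef f i) : Qp) < padic_norm beta.
Proof.
move=> /andP[i2 iN]; have [g [fg gm sg]] := (annihilator_factor fP).
have b0 : 0 < padic_norm beta by rewrite (um_gt0 um).
rewrite /minpoly_coef ratr_padicE rmorphN (umN um) /= -coef_map fg mulrBl coefB.
apply: (umB_lt um).
  rewrite coefXM; case: eqP => [_|/eqP m0]; first by rewrite (um0 um).
  apply: lt_trans beta_gt1; apply: (cofactor_coef_lt1 fg gm); rewrite sg.
  by move: (size f) m0 i2 iN => m *; lia.
rewrite mul_polyC coefZ (umM um) gtr_pMr //; apply: (cofactor_coef_lt1 fg gm).
by rewrite sg; move: (size f) i2 iN => m *; lia.
Qed.

(* Positive integers m have expansions with digits in [0, 1), so conjugation  *)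
(* to a root z with |z| > 1 bounds them all by 1 / (|z| - 1).                 *)
Lemma archimedean_root_le1 (z : R[i]) : root (map_poly ratr f) z -> `|z| <= 1.
Proof.
move=> fz; rewrite real_leNgt ?realE ?normr_ge0 ?ler01 //; apply/negP => z1.
(* The norm on R[i] is complex-valued; t is its value in R, where the Archimedean property
   applies. *)
set t := Num.sqrt ((complex.Re z) ^+ 2 + (complex.Im z) ^+ 2).
have tE : `|z| = (t%:C)%C by rewrite normc_def.
have t1 : 1 < t by rewrite -ltcR -tE.
have t0 : 0 < t - 1 by rewrite subr_gt0.
have bound (m : nat) : m%:R <= (t - 1)^-1.
  have mA : (m%:R : rat) \in Ap p by rewrite rpred_nat.
  have [|M [d [d01 _ rel]]] := Fin_relation (j := 0) fP mA.
    rewrite expr0 divr1 ratr_nat; exact: (padic_norm_int_le1 _ m%:Z).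
  have := rel _ (@ratr R[i]) z fz; rewrite expr0 mul1r /= ratr_nat => e.
  have := @norm_digit_sum_le R[i] (ratr \o d) M z (ltW z1).
  rewrite -e normrM normr_nat normrX => /(_ _) h.
  have {h} := h _; rewrite -mulrA tE.
  have -> : m%:R * ((t%:C)%C ^+ M * ((t%:C)%C - 1)) = ((m%:R * (t ^+ M * (t - 1)))%:C)%C.
    by rewrite !rmorphM rmorphXn rmorphB rmorph_nat rmorph1.
  have -> : (t%:C)%C ^+ M - 1 = ((t ^+ M - 1)%:C)%C by rewrite rmorphB rmorphXn rmorph1.
  move=> h; have {h} : m%:R * (t ^+ M * (t - 1)) <= t ^+ M - 1.
    rewrite -lecR; apply: h => k /=; have /andP[d0 d1] := d01 k.
    rewrite ger0_norm ?ler0q // -(rmorph1 (@ratr R[i])) ler_rat; exact: ltW.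
  have tM : 0 < t ^+ M by rewrite exprn_gt0 // (lt_trans ltr01).
  move=> h; rewrite -[_^-1]mul1r ler_pdivlMr //.
  rewrite -(ler_pM2l tM) mulr1 mulrCA; apply: le_trans h _.
  by rewrite gerBl.
have := archi_boundP (ltW (_ : 0 < (t - 1)^-1)); rewrite invr_gt0 => /(_ t0).
by rewrite ltNge bound.
Qed.

(** On the unit circle f_0 would be 1 or -1, but f_0 = -a_n is the first entry of -a, a point of
    D_n^0. *)
Lemma archimedean_root_lt1 (z : R[i]) : f \is a polyOver (Ap p) ->
  root (map_poly ratr f) z -> `|z| < 1.
Proof.
move=> fA fz; rewrite lt_neqAle archimedean_root_le1 // andbT; apply/eqP => z1.
have [fm fb _] := fP.
have D0 := @Fin_srs_D0 _ p_pr _ beta_gt1 f fA fm fb annihilator_dominant R fP FinE.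
have n0 := monic_root_size_gt1 fm fb.
have := srs_D0_neq1 (j0 := Ordinal n0) D0 erefl.
rewrite !mxE /= subn0 /minpoly_coef subnn rmorphN opprK => /negP; apply.
have [|->|->] := annihilator_unit_circle fP _ z1; first exact: fz.
  by rewrite rmorph1 normr1.
by rewrite rmorphN rmorph1 normrN1.
Qed.

End FinProperty.

(** * Dominance of a_1 and the equivalence *)

(** Descending induction from w_n = 0 bounds |w_1| below |a_1| when n > 1, and beta = w_1 + a_1.
    This converts dominance by a_1 into the dominance by beta assumed in [srs_D0_Fin]. *)
Lemma dominant_norm_eq (p : nat) (p_pr : prime p) (beta : padic p_pr) (f : {poly rat}) :
  1 < padic_norm beta -> f \is monic -> root (map_poly ratr f) beta ->
  (forall i : nat, (2 <= i <= (size f).-1)%N ->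
    padic_norm (ratr (minpoly_coef f i) : padic p_pr) <
    padic_norm (ratr (minpoly_coef f 1) : padic p_pr)) ->
  padic_norm (ratr (minpoly_coef f 1) : padic p_pr) = padic_norm beta.
Proof.
move=> b1 fm fb dom; pose um := padic_norm_ultrametric p_pr.
have b0 : 0 < padic_norm beta by apply: lt_trans b1.
have w1 := quot_basisS beta f 0; rewrite quot_basis0 // mulr1 in w1.
have wn := quot_basis_size fm fb.
have n_gt0 := monic_root_size_gt1 fm fb.
set n := (size f).-1 in dom wn n_gt0; set a1 := ratr _ in w1 dom *.
have [n1|n1] := eqVneq n 1%N; first by rewrite w1 -n1 wn add0r.
have a1_gt0 : 0 < padic_norm a1.
  by apply: le_lt_trans (um_ge0 um _) (dom 2%N _); rewrite leqnn ltn_neqAle eq_sym n1.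
suff wlt : padic_norm (quot_basis beta f 1) < padic_norm a1.
  by rewrite w1 addrC (umDl um).
suff H k : (k < n)%N -> padic_norm (quot_basis beta f (n - k)) < padic_norm a1.
  have -> : 1%N = (n - n.-1)%N by rewrite -subn1 subKn.
  by apply: H; rewrite prednK.
elim: k => [|k IH] kn; first by rewrite subn0 wn (um0 um).
rewrite -(ltr_pM2l b0) -(umM um) quot_basisS subnSK; last exact: ltnW.
apply: lt_trans (_ : padic_norm a1 < _); last by rewrite ltr_pMl.
by apply: (umD_lt um); [apply: IH; apply: ltnW|apply: dom; lia].
Qed.

Theorem theorem5p4 (p : nat) (p_pr : prime p) (R : realType)
    (* K is an algebraic closure of Q_p, absK the extension of |.|_p to K *)
    (K : closedFieldType) (iota : {rmorphism padic p_pr -> K})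
    (K_algebraic : forall x : K, algebraicOver iota x)
    (absK : K -> R) (absK_ext : extends_padic_norm iota absK)
    (beta : padic p_pr) (beta_gt1 : 1 < padic_norm beta) :
  Fin beta = Ap_adjoin_inv beta `&` padic_integers p_pr
  <->
  is_PC iota absK beta /\
  exists f : {poly rat},
    [/\ is_minpoly f beta,
        forall i : nat, (2 <= i <= (size f).-1)%N ->
          padic_norm (ratr (minpoly_coef f i) : padic p_pr) <
          padic_norm (ratr (minpoly_coef f 1) : padic p_pr) &
        - minpoly_vec R f \in srs_D0 R (size f).-1].
Proof.
split=> [FinE|[_ [f [[fA fm _ fb] dom D0]]]]; last first.
  have a1E := dominant_norm_eq beta_gt1 fm fb dom.
  by apply: (srs_D0_Fin beta_gt1 fA fm fb _ D0) => i /dom; rewrite a1E.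
have [f [fP fA]] := Fin_annihilator beta_gt1 FinE.
have [fm fb _] := fP.
have fmin : is_minpoly f beta.
  by split=> //; apply: annihilator_Ap_irreducible fP.
have dom := annihilator_dominant beta_gt1 FinE absK_ext fP.
have D0 := Fin_srs_D0 beta_gt1 fA fm fb dom R fP FinE.
have a1E : padic_norm (ratr (minpoly_coef f 1) : padic p_pr) = padic_norm beta.
  have := quot_basisS beta f 0; rewrite quot_basis0 // mulr1 => e.
  pose um := padic_norm_ultrametric p_pr.
  have -> : ratr (minpoly_coef f 1) = beta - quot_basis beta f 1.
    by rewrite {1}e addrC addKr.
  rewrite (umDl um) // (umN um); apply: lt_trans (beta_gt1).
  apply: (quot_basis_lt1 beta_gt1 fm fb dom); exact: monic_root_size_gt1 fm fb.
split; last by exists f; split=> // i; rewrite a1E; apply: dom.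
exists f; split=> //.
  move=> x; exact: (conjugate_abs_le1 beta_gt1 FinE absK_ext fP).
move=> z; exact: (archimedean_root_lt1 beta_gt1 FinE absK_ext fP fA).
Qed.
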